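(* For every finite graph $F$ with at least one edge and every integer $r\ge 2$, the vertex balanced Ramsey game with parameters $F$ and $r$ and the vertex Achlioptas game with parameters $F$ and $r$ have the same threshold (i.e. their threshold functions $p_0(F,r,n)$ coincide up to constant factors).
   Context: All asymptotics are for $n\to\infty$; $f\ll g$ means $f=o(g)$, $f\gg g$ means $f=\omega(g)$; a.a.s. means with probability tending to $1$ as $n\to\infty$. $F$ and $r\geq 2$ are fixed. Vertex games with parameters $F$ and $r$: assume $r$ divides $n$. At the start a binomial random graph $G(n,p)$, $p=p(n)$, on vertex set $\{v_1,\dots,v_n\}$ is generated (each of the $\binom n2$ edges is included independently with probability $p$), hidden from the player. In step $i$ ($1\le i\le n/r$) the vertices $v_{(i-1)r+1},\dots,v_{ir}$ are revealed, so that the player sees exactly the graph induced by $v_1,\dots,v_{ir}$. Vertex balanced Ramsey game: in each step the player must immediately assign each of $r$ available colors to exactly one of the $r$ new vertices. She wins if all $n$ vertices are colored without creating a (vertex-)monochromatic copy of $F$ (copy = not necessarily induced subgraph isomorphic to $F$). Vertex Achlioptas game: in each step the player must immediately select exactly one of the $r$ new vertices; the other $r-1$ are discarded along with all incident edges. She wins if after all $n/r$ steps the graph induced by the selected vertices contains no copy of $F$. Threshold: $p_0=p_0(F,r,n)$ is a threshold of such a game if (i) for every $p(n)\ll p_0$ there is a player strategy that a.a.s. wins, and (ii) for every $p(n)\gg p_0$ every player strategy a.a.s. loses. Such a threshold is determined up to constant factors. *)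

(* Defs.v *)
From mathcomp Require Import all_boot all_order all_algebra all_fingroup.
From mathcomp Require Import boolp classical_sets functions reals topology.
From mathcomp Require Import normedtype landau sequences.

Set Implicit Arguments.
Unset Strict Implicit.
Unset Printing Implicit Defensive.

Import Order.TTheory GRing.Theory Num.Theory.
Import numFieldNormedType.Exports.

Local Open Scope ring_scope.

(* A simple graph on a finite vertex type V is given by its edge set, a set of
   two-element subsets of V; [pairs V] is the edge set of the complete graph. *)
Definition pairs (V : finType) : {set {set V}} :=
  [set e : {set V} | #|e| == 2%N].

Definition is_graph (V : finType) (G : {set {set V}}) : bool :=
  G \subset pairs V.

(* G contains a (not necessarily induced) copy of F all of whose vertices,
   isolated ones included, lie in S. *)
Definition has_copy (W V : finType) (F : {set {set W}}) (G : {set {set V}})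
    (S : {set V}) : bool :=
  [exists f : {ffun W -> V},
    [&& injectiveb f,
        [forall x, f x \in S] &
        [forall e in F, f @: e \in G]]].

Definition gnp_prob (R : realType) (V : finType) (p : R)
    (A : pred {set {set V}}) : R :=
  \sum_(G : {set {set V}} | is_graph G && A G)
    \prod_(e in pairs V) (if e \in G then p else 1 - p).

(* The game with N steps is played on n = N * r vertices; the pair (i, j) is the
   vertex v_(i r + j + 1), so that step i + 1 reveals the vertices (i, _). *)
Notation vertex N r := ('I_N * 'I_r)%type.
Notation graph N r := {set {set vertex N r}}.

(* The edges of the subgraph induced by the vertices of the first k steps. *)
Definition revealed (N r : nat) (G : graph N r) (k : nat) : graph N r :=
  [set e : {set vertex N r} in G | [forall v in e, (nat_of_ord v.1 < k)%N]].

(* A strategy maps the graph revealed so far and the sequence of the player's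
   earlier decisions (whose size is the number of completed steps) to the
   decision for the current step. Deterministic strategies suffice: for each n a
   randomized one is a mixture of finitely many deterministic ones. *)
Definition strategy (D : Type) (N r : nat) : Type :=
  graph N r -> seq D -> D.

Fixpoint history (D : Type) (N r : nat) (s : strategy D N r) (G : graph N r)
    (k : nat) : seq D :=
  if k is i.+1 then
    let h := history s G i in rcons h (s (revealed G i.+1) h)
  else [::].

Definition decision (D : Type) (N r : nat) (s : strategy D N r)
    (G : graph N r) (i : nat) : D :=
  s (revealed G i.+1) (history s G i).

(* A decision in the balanced Ramsey game is a permutation pi of 'I_r: the j-th
   new vertex receives the color pi j. *)
Definition ramsey_color (N r : nat) (s : strategy {perm 'I_r} N r)
    (G : graph N r) (v : vertex N r) : 'I_r :=
  decision s G v.1 v.2.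

Definition ramsey_wins (W : finType) (F : {set {set W}}) (r N : nat)
    (s : strategy {perm 'I_r} N r) (G : graph N r) : bool :=
  [forall c : 'I_r, ~~ has_copy F G [set v : vertex N r | ramsey_color s G v == c]].

(* A decision in the Achlioptas game is the index of the selected vertex. *)
Definition achlioptas_selected (N r : nat) (s : strategy 'I_r N r)
    (G : graph N r) : {set vertex N r} :=
  [set v : vertex N r | v.2 == decision s G v.1].

Definition achlioptas_wins (W : finType) (F : {set {set W}}) (r N : nat)
    (s : strategy 'I_r N r) (G : graph N r) : bool :=
  ~~ has_copy F G (achlioptas_selected s G).

Local Open Scope classical_set_scope.

(* Asymptotics are for n -> oo along the multiples n = N * r of r. *)
Definition much_smaller (R : realType) (r : nat) (f g : nat -> R) : Prop :=
  (fun N => f (N * r)%N : R^o) =o_\oo (fun N => g (N * r)%N : R^o).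

Definition same_order (R : realType) (r : nat) (f g : nat -> R) : Prop :=
  (fun N => f (N * r)%N : R^o) =Theta_\oo (fun N => g (N * r)%N : R^o).

Definition is_threshold (R : realType) (D : Type) (r : nat)
    (wins : forall N, strategy D N r -> graph N r -> bool)
    (p0 : nat -> R) : Prop :=
  [/\ forall n, 0 < p0 n,
      forall p : nat -> R, (forall n, 0 <= p n <= 1) ->
        much_smaller r p p0 ->
        exists s : forall N, strategy D N r,
          gnp_prob (p (N * r)%N) (wins N (s N)) @[N --> \oo] --> (1 : R) &
      forall p : nat -> R, (forall n, 0 <= p n <= 1) ->
        much_smaller r p0 p ->
        forall s : forall N, strategy D N r,
          gnp_prob (p (N * r)%N) (fun G => ~~ wins N (s N) G)
            @[N --> \oo] --> (1 : R)].

Definition ramsey_threshold (R : realType) (W : finType) (F : {set {set W}})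
    (r : nat) (p0 : nat -> R) : Prop :=
  is_threshold (@ramsey_wins W F r) p0.

Definition achlioptas_threshold (R : realType) (W : finType)
    (F : {set {set W}}) (r : nat) (p0 : nat -> R) : Prop :=
  is_threshold (@achlioptas_wins W F r) p0.

(* Main.v *)
Require Import Defs.
From mathcomp Require Import all_boot all_order all_algebra all_fingroup.
From mathcomp Require Import boolp classical_sets functions reals topology.
From mathcomp Require Import normedtype landau sequences.
From mathcomp Require Import exp ring lra zify.
From mathcomp Require Import fintype finset.

(* Let p = n ^ (- theta). For a list s = u :: s' of vertices of F from youngest to
   oldest, [danger s] is the exponent of the probability that a vertex completes
   a copy of s in a color class: it is the minimum, over the subsets J of s', of
   the exponent of the expected number of copies of J in that class, where each
   x in J costs [cost x] = 1 + (r - 1) danger (x and older): one for its round,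
   the rest because the other r - 1 vertices of the round were as dangerous. The
   r vertices of a round are all forced to complete s about
   n ^ (1 + r danger s) times; theta is chosen so that the largest over the
   orderings of F of the smallest such exponent over the suffixes is 0.

   Above n ^ (- theta), fix an ordering for which these exponents are all
   nonnegative. Whatever the player selects, an r-ary tree of rounds along it
   forces a copy of F, and the second moment method applies directly although the
   requested edges depend on her decisions, because adaptively requested edges
   are still present independently.

   Below n ^ (- theta), the Ramsey player picks the permutation minimizing the
   danger lexicographically, the shorter of two equally dangerous lists being worse.
   Explaining why a vertex was selected, then why the vertices in its explanation
   were, yields subgraphs with few rounds and many edges. Each strict drop of the
   danger lowers the exponent by a constant and between drops the lists get
   shorter, so these subgraphs have bounded size, and a.a.s. they do not occur.

   A balanced Ramsey strategy yields an Achlioptas strategy (select the vertex of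
   a fixed color), so both games have threshold n ^ (- theta). *)

Set Implicit Arguments.
Unset Strict Implicit.
Unset Printing Implicit Defensive.

Import Order.TTheory GRing.Theory Num.Theory.
Import numFieldNormedType.Exports.

Local Open Scope ring_scope.

(** * Random graphs and adaptive exposure *)

Section RandomGraph.
Variables (R : realType) (V : finType) (p : R).
Implicit Types (G L U : {set {set V}}) (A B : pred {set {set V}}).

Definition weight G : R := \prod_(e in pairs V) (if e \in G then p else 1 - p).

(** Each edge of L contributes p, each edge outside U contributes 1 - p, and each edge in between p
    + (1 - p) = 1. *)
Lemma weight_interval L U : L \subset U -> U \subset pairs V ->
  \sum_(G : {set {set V}} | (L \subset G) && (G \subset U)) weight G =
  p ^+ #|L| * (1 - p) ^+ #|pairs V :\: U|.
Proof.
move=> sLU sUP.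
(* [f] and [g] weigh presence and absence of [e], with 0 for what the interval forbids, so only the
   G between L and U survive in the expanded product. *)
pose f e : R := if e \in U then p else 0.
pose g e : R := if e \in L then 0 else if e \in pairs V then 1 - p else 1.
have -> : p ^+ #|L| * (1 - p) ^+ #|pairs V :\: U| = \prod_e (f e + g e).
  rewrite (bigID (mem L)) /=; congr (_ * _).
    rewrite -prodr_const; apply: eq_bigr => e eL.
    by rewrite /f /g eL (subsetP sLU) // addr0.
  rewrite -prodr_const big_mkcond /= [RHS]big_mkcond /=.
  apply: eq_bigr => e _; rewrite inE /f /g.
  case: (boolP (e \in U)) => /= eU.
    by case: (e \in L) => //=; rewrite (subsetP sUP) // subrKC.
  case: (boolP (e \in L)) => [/(subsetP sLU)|_] /=; first by rewrite (negPf eU).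
  by rewrite add0r.
rewrite bigA_distr [RHS](bigID (fun G => (L \subset G) && (G \subset U))) /=.
rewrite [X in _ = _ + X]big1 ?addr0; last first.
  move=> G; rewrite negb_and => /orP[] /subsetPn[e e1 e2].
    by rewrite (bigD1 e) //= (negPf e2) /g e1 mul0r.
  by rewrite (bigD1 e) //= e1 /f (negPf e2) mul0r.
apply: eq_bigr => G /andP[sLG sGU].
rewrite /weight big_mkcond /=; apply: eq_bigr => e _.
case: (boolP (e \in G)) => eG.
  by rewrite /f (subsetP sGU) // (subsetP sUP) // (subsetP sGU).
rewrite /g; case: (boolP (e \in L)) => [/(subsetP sLG)|//].
by rewrite (negPf eG).
Qed.

Lemma weight_graph G : is_graph G ->
  weight G = p ^+ #|G| * (1 - p) ^+ #|pairs V :\: G|.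
Proof.
move=> gG; rewrite -weight_interval //.
by rewrite (big_pred1 G) // => H; rewrite /= eqEsubset andbC.
Qed.

Lemma sum_weight : \sum_(G : {set {set V}} | is_graph G) weight G = 1.
Proof.
have := @weight_interval finset.set0 (pairs V) (sub0set _) (subxx _).
rewrite cards0 setDv cards0 !expr0 mulr1 => <-.
by apply: eq_bigl => G; rewrite sub0set.
Qed.

Lemma gnp_prob_sub L : L \subset pairs V ->
  gnp_prob p (fun G => L \subset G) = p ^+ #|L|.
Proof.
move=> sL; have := weight_interval sL (subxx _).
rewrite setDv cards0 expr0 mulr1 => <-.
by apply: eq_bigl => G; rewrite andbC.
Qed.

Lemma gnp_probC A : gnp_prob p (fun G => ~~ A G) = 1 - gnp_prob p A.
Proof.
apply/eqP; rewrite eq_sym subr_eq addrC -sum_weight /gnp_prob.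
by rewrite [X in X == _](bigID A).
Qed.

Section Positive.
Hypothesis p01 : 0 <= p <= 1.

Lemma weight_ge0 G : 0 <= weight G.
Proof.
have /andP[p0 p1] := p01.
by apply: prodr_ge0 => e _; case: ifP => _; rewrite ?subr_ge0.
Qed.

Lemma gnp_prob_mono A B : (forall G, is_graph G -> A G -> B G) ->
  gnp_prob p A <= gnp_prob p B.
Proof.
move=> AB; rewrite /gnp_prob big_mkcond [leRHS]big_mkcond /=.
apply: ler_sum => G _.
case: (boolP (is_graph G)) => //= gG; case: (boolP (A G)) => [/AB -> //|_].
by case: ifP => // _; exact: weight_ge0.
Qed.

Lemma gnp_prob_le1 A : gnp_prob p A <= 1.
Proof.
apply: le_trans (_ : gnp_prob p xpredT <= _); first exact: gnp_prob_mono.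
by rewrite -sum_weight le_eqVlt /gnp_prob; under eq_bigl do rewrite andbT; rewrite eqxx.
Qed.

Lemma gnp_prob_union (I : finType) (P : pred I) (A : I -> pred {set {set V}})
    (B : pred {set {set V}}) :
  (forall G, is_graph G -> B G -> exists2 i, P i & A i G) ->
  gnp_prob p B <= \sum_(i | P i) gnp_prob p (A i).
Proof.
move=> BA; rewrite /gnp_prob (exchange_big_dep (@is_graph V)) /=; last first.
  by move=> i G _ /andP[].
rewrite big_mkcondr /=; apply: ler_sum => G gG.
case: ifP => [/(BA _ gG)[i Pi Ai]|_]; last first.
  by apply: sumr_ge0 => i _; exact: weight_ge0.
rewrite (bigD1 i) ?Pi ?gG //= lerDl.
by apply: sumr_ge0 => j _; exact: weight_ge0.
Qed.

End Positive.

Definition gnp_mean (X : {set {set V}} -> R) : R :=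
  \sum_(G : {set {set V}} | is_graph G) weight G * X G.

(** Chebyshev's inequality: on A, the variable Z deviates from its mean by the whole mean. *)
Lemma chebyshev0 (Z : {set {set V}} -> R) (A : pred {set {set V}}) :
  0 <= p <= 1 -> (forall G, is_graph G -> A G -> Z G = 0) ->
  gnp_prob p A * gnp_mean Z ^+ 2 <=
  gnp_mean (fun G => Z G ^+ 2) - gnp_mean Z ^+ 2.
Proof.
move=> p01 AZ; set m := gnp_mean Z.
have -> : gnp_mean (fun G => Z G ^+ 2) - m ^+ 2 =
    gnp_mean (fun G => (Z G - m) ^+ 2).
  have -> : gnp_mean (fun G => (Z G - m) ^+ 2) =
     gnp_mean (fun G => Z G ^+ 2) - m *+ 2 * gnp_mean Z
     + m ^+ 2 * \sum_(G : {set {set V}} | is_graph G) weight G.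
    rewrite /gnp_mean !mulr_sumr -sumrB -big_split /=.
    by apply: eq_bigr => G _; ring.
  by rewrite sum_weight -/m; ring.
rewrite /gnp_prob mulr_suml /gnp_mean big_mkcondr /=; apply: ler_sum => G gG.
case: ifP => [AG|_]; last by rewrite mulr_ge0 ?sqr_ge0 ?weight_ge0.
by rewrite AZ // sub0r sqrrN.
Qed.

End RandomGraph.

(** * Adaptively requested edges *)

Section AdaptiveExposure.
Variables (V : finType) (rk : {set V} -> nat).
Implicit Types G H : {set {set V}}.

(** The rank is a clock: requests of rank i are known once all edges of smaller rank are exposed. *)
Definition adaptive (B : {set {set V}} -> {set {set V}}) : Prop :=
  forall G H e, (forall e', (rk e' < rk e)%N -> (e' \in G) = (e' \in H)) ->
    (e \in B G) = (e \in B H).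

Lemma adaptiveU B1 B2 : adaptive B1 -> adaptive B2 ->
  adaptive (fun G => B1 G :|: B2 G).
Proof.
by move=> h1 h2 G H e GH; rewrite !inE (h1 _ _ _ GH) (h2 _ _ _ GH).
Qed.

Variables (B : {set {set V}} -> {set {set V}}).
Hypotheses (adB : adaptive B) (BP : forall G, B G \subset pairs V).

Fixpoint fill H k : {set {set V}} :=
  if k is i.+1 then fill H i :|: [set e in B (fill H i) | rk e == i] else H.

Lemma fill_rk H k e : (rk e < k)%N -> (e \in fill H k) = (e \in fill H (rk e).+1).
Proof.
elim: k => // k IH; rewrite ltnS leq_eqVlt => /orP[/eqP <- //|lt_ek].
by rewrite inE IH // inE (ltn_eqF lt_ek) andbF orbF.
Qed.

Lemma fill_lt H k e : (k <= rk e)%N -> (e \in fill H k) = (e \in H).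
Proof.
elim: k => // k IH lek; rewrite inE IH 1?ltnW // inE.
by rewrite (gtn_eqF lek) andbF orbF.
Qed.

Definition completion H := fill H (\max_(e : {set V}) rk e).+1.

(** Later stages of [fill] only touch edges of larger rank, so the request for [e] is settled at its
    own stage. *)
Lemma completionE H e :
  (e \in completion H) = (e \in H) || (e \in B (completion H)).
Proof.
have rkm e' : (rk e' < (\max_(e : {set V}) rk e).+1)%N by rewrite ltnS leq_bigmax.
rewrite /completion fill_rk // inE fill_lt // inE eqxx andbT.
congr (_ || _); apply: adB => e' lt_e'.
by rewrite [RHS]fill_rk // fill_rk.
Qed.

(** The fibre of [completion] over G is an interval of graphs, whose weight [weight_interval] gives.
    From right to left, the two graphs are identified by induction on the rank. *)
Lemma completionP G H :
  (completion H == G) = [&& B G \subset G, G :\: B G \subset H & H \subset G].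
Proof.
apply/eqP/and3P => [<-|[BG GH HG]].
  split; apply/subsetP => e.
  - by rewrite [in X in _ -> X]completionE => ->; rewrite orbT.
  - by rewrite inE [in X in _ && X]completionE => /andP[/negPf ->]; rewrite orbF.
  - by rewrite completionE => ->.
have GE e : (e \in G) = (e \in H) || (e \in B G).
  apply/idP/orP => [eG|[/(subsetP HG)|/(subsetP BG)]//].
  case: (boolP (e \in B G)) => eB; first by right.
  by left; apply: (subsetP GH); rewrite inE eB eG.
suff eqG n e : (rk e < n)%N -> (e \in completion H) = (e \in G).
  by apply/setP => e; apply: (eqG (rk e).+1).
elim: n e => // n IH e; rewrite ltnS => le_en.
rewrite completionE GE; congr (_ || _); apply: adB => e' lt_e'.
by apply: IH; exact: leq_trans le_en.
Qed.

(* Filling in, rank by rank, the edges requested by B sends the random graph to a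
   graph containing the edges B requests of it; the fibre over G has weight
   [weight G / p ^ #|B G|]. *)
Lemma adaptive_mean (R : realType) (p : R) : p != 0 ->
  gnp_mean p (fun G => (B G \subset G)%:R / p ^+ #|B G|) = 1.
Proof.
move=> p0; rewrite -[RHS](sum_weight V p) /gnp_mean.
rewrite [RHS](partition_big completion (@is_graph V)) /=; last first.
  move=> H gH; apply/subsetP => e; rewrite completionE => /orP[/(subsetP gH)//|].
  exact/subsetP.
apply: eq_bigr => G gG.
case: (boolP (B G \subset G)) => BG; last first.
  rewrite mul0r mulr0 big_pred0 // => H.
  by apply/negP => /andP[_]; rewrite completionP (negPf BG).
rewrite (eq_bigl (fun H => (G :\: B G \subset H) && (H \subset G))); last first.
  move=> H /=; rewrite completionP BG /=.
  case: (boolP (H \subset G)) => HG; last by rewrite !andbF.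
  by rewrite /is_graph (subset_trans HG gG).
rewrite weight_interval ?subsetDl // (weight_graph p gG) mulr1n mul1r.
have -> : #|G| = (#|G :\: B G| + #|B G|)%N.
  by rewrite -(cardsID (B G) G) (setIidPr BG) addnC.
by rewrite exprD -!mulrA; congr (_ * _); rewrite mulrCA divff ?mulr1 // expf_neq0.
Qed.

End AdaptiveExposure.

(** * Danger and the critical exponent *)

Section Danger.
Variables (R : realType) (W : finType) (F : {set {set W}}) (r : nat).
Hypothesis hF : is_graph F.
Implicit Types (s : seq W) (J : {set W}) (th : R).

Definition nedges J : nat := #|[set e in F | e \subset J]|.

(** Cost and danger are mutually recursive, so the danger is inlined here; [cost_cons] restores the
    intended form. *)
Fixpoint cost th s (x : W) : R :=
  if s is u :: s' then
    if x == u then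
      1 + r.-1%:R * \big[Num.min/0]_(J : {set W} | J \subset s')
        (\sum_(y in J) cost th s' y - th * (nedges (u |: J))%:R)
    else cost th s' x
  else 0.

Definition danger th s : R :=
  if s is u :: s' then \big[Num.min/0]_(J : {set W} | J \subset s')
     (\sum_(y in J) cost th s' y - th * (nedges (u |: J))%:R)
  else 0.

Lemma cost_cons th u s x :
  cost th (u :: s) x =
  if x == u then 1 + r.-1%:R * danger th (u :: s) else cost th s x.
Proof. by []. Qed.

Lemma danger_le th u s J : J \subset s ->
  danger th (u :: s) <= \sum_(y in J) cost th s y - th * (nedges (u |: J))%:R.
Proof. by move=> Js; apply: bigmin_le_cond. Qed.

Lemma danger_le0 th s : danger th s <= 0.
Proof. by case: s => [|u s] //=; apply: bigmin_le_id. Qed.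

Lemma edge_neq x y : [set x; y] \in F -> x != y.
Proof.
move=> /(subsetP hF); rewrite inE cards2.
by case: (x != y).
Qed.

Lemma nedges1 u : nedges [set u] = 0%N.
Proof.
apply/eqP; rewrite cards_eq0; apply/eqP/setP => e; rewrite !inE.
apply/negP => /andP[/(subsetP hF)]; rewrite inE => /eqP e2 /subset_leq_card.
by rewrite e2 cards1.
Qed.

Lemma nedgesU1 u J : u \notin J ->
  nedges (u |: J) = (nedges J + #|[set x in J | [set u; x] \in F]|)%N.
Proof.
move=> uJ; rewrite /nedges -(cardsID [set e : {set W} | u \notin e]).
congr (_ + _)%N.
  apply: eq_card => e; rewrite !inE; case: (e \in F) => //=.
  apply/andP/idP => [[eJ ue]|eJ].
    apply/subsetP => x xe; have /setU1P[xu|//] := subsetP eJ x xe.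
    by rewrite -xu xe in ue.
  by split; [exact: subset_trans (subsetUr _ _)|apply: contra uJ; exact: (subsetP eJ)].
have inj : {in [set x in J | [set u; x] \in F] &, injective (fun x => [set u; x])}.
  move=> x y; rewrite !inE => /andP[xJ _] /andP[yJ _] /setP /(_ x).
  rewrite !inE eqxx orbT => /esym/orP[/eqP xu|/eqP //].
  by rewrite -xu xJ in uJ.
rewrite -(card_in_imset inj); apply: eq_card => e; rewrite !inE negbK.
apply/andP/imsetP => [[ue /andP[eF eJ]]|[x]].
  have := subsetP hF e eF; rewrite inE => /cards2P [a [b [ab eE]]].
  have [x xu ex] : exists2 x, x != u & e = [set u; x].
    move: ue; rewrite eE !inE => /orP[] /eqP ->.
      by exists b; rewrite // eq_sym.
    by exists a; rewrite // finset.setUC.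
  exists x => //; rewrite inE -ex eF andbT.
  have /setU1P[/eqP|//] : x \in u |: J by apply: (subsetP eJ); rewrite ex !inE eqxx orbT.
  by rewrite (negPf xu).
rewrite inE => /andP[xJ xF] ->; rewrite !inE eqxx xF /=; split => //.
by rewrite subUset !sub1set !inE eqxx xJ orbT.
Qed.

(** The default 0 of the minimum is itself attained, at J empty, because a single vertex spans no
    edge. *)
Lemma danger_attained th u s : exists2 J : {set W}, J \subset s &
  danger th (u :: s) = \sum_(y in J) cost th s y - th * (nedges (u |: J))%:R.
Proof.
set f := fun J : {set W} =>
  \sum_(y in J) cost th s y - th * (nedges (u |: J))%:R.
have f0 : f finset.set0 = 0.
  by rewrite /f big_set0 finset.setU0 nedges1 mulr0 subr0.
have -> : danger th (u :: s) =
    \big[Num.min/f finset.set0]_(J : {set W} | J \subset s) f J by rewrite f0.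
apply: (big_ind (fun z => exists2 J : {set W}, (J \subset s) & z = f J)).
- by exists finset.set0; [apply/subsetP => x; rewrite inE|].
- by move=> x y [A sA ->] [B sB ->]; case: leP; [exists A|exists B].
- by move=> J Js; exists J.
Qed.

(** The smallest exponent, over the suffixes, of the number of rounds all of whose vertices complete
    the suffix; the empty suffix gives 1, for all rounds. *)
Fixpoint margin th s : R :=
  if s is u :: s' then Num.min (1 + r%:R * danger th s) (margin th s') else 1.

Lemma margin_cons th u s :
  margin th (u :: s) = Num.min (1 + r%:R * danger th (u :: s)) (margin th s).
Proof. by []. Qed.

Lemma continuous_bigmin (T : topologicalType) (I : Type) (l : seq I) (P : pred I)
    (f : I -> T -> R^o) (c : R) :
  (forall i, continuous (f i)) ->
  continuous (fun t => \big[Num.min/c]_(i <- l | P i) f i t : R^o).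
Proof.
move=> fc t; elim: l => [|i l IH].
  under eq_fun do rewrite big_nil; exact: cvg_cst.
under eq_fun do rewrite big_cons; case: (P i) => //.
exact: (@continuous_min _ _ (f i) (fun t => \big[Num.min/c]_(j <- l | P j) f j t) t (fc i t) IH).
Qed.

Lemma continuous_bigsum (T : topologicalType) (I : Type) (l : seq I) (P : pred I)
    (f : I -> T -> R^o) :
  (forall i, continuous (f i)) ->
  continuous (fun t => \sum_(i <- l | P i) f i t : R^o).
Proof.
move=> fc t; elim: l => [|i l IH].
  under eq_fun do rewrite big_nil; exact: cvg_cst.
under eq_fun do rewrite big_cons; case: (P i) => //.
by apply: cvgD; [exact: fc|exact: IH].
Qed.

Lemma cost_continuous s x : continuous (fun th : R^o => cost th s x : R^o).
Proof.
elim: s x => [|u s IH] x th /=; first exact: cvg_cst.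
case: (x == u) => //.
apply: cvgD; first exact: cvg_cst.
apply: cvgM; first exact: cvg_cst.
apply: continuous_bigmin => J {}th.
apply: cvgB.
  by apply: continuous_bigsum => y; exact: IH.
by apply: cvgM; [exact: cvg_id|exact: cvg_cst].
Qed.

Lemma danger_continuous s : continuous (fun th : R^o => danger th s : R^o).
Proof.
case: s => [|u s] th /=; first exact: cvg_cst.
apply: continuous_bigmin => J {}th.
apply: cvgB.
  by apply: continuous_bigsum => y; exact: cost_continuous.
by apply: cvgM; [exact: cvg_id|exact: cvg_cst].
Qed.

Lemma margin_continuous s : continuous (fun th : R^o => margin th s : R^o).
Proof.
elim: s => [|u s IH] th; first exact: cvg_cst.
apply: (@continuous_min _ _ (fun th => 1 + r%:R * danger th (u :: s))); last exact: IH.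
apply: cvgD; first exact: cvg_cst.
by apply: cvgM; [exact: cvg_cst|exact: danger_continuous].
Qed.

Lemma danger0 s : danger 0 s = 0.
Proof.
have c1 t x : 0 <= cost 0 t x.
  elim: t x => [|u t IH] x //; rewrite cost_cons; case: ifP => // _.
  rewrite /danger bigmin_eq_id ?mulr0 ?addr0 // => J _.
  by rewrite mul0r subr0 sumr_ge0.
case: s => [|u s] //; rewrite /danger bigmin_eq_id // => J _.
by rewrite mul0r subr0 sumr_ge0.
Qed.

Lemma margin0 s : margin 0 s = 1.
Proof.
by elim: s => [|u s IH] //; rewrite margin_cons IH danger0 mulr0 addr0 minxx.
Qed.

Lemma cost_le1 th s x : cost th s x <= 1.
Proof.
elim: s => [|u s IH]; first exact: ler01.
rewrite cost_cons; case: ifP => // _.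
by rewrite gerDl mulr_ge0_le0 ?ler0n ?danger_le0.
Qed.

(** One edge suffices: with J the older endpoint, the danger of the suffix starting at the younger
    one is at most 1 - 2 = -1, and r is at least 2. *)
Lemma margin2 s x y : [set x; y] \in F -> x \in s -> y \in s -> (1 < r)%N ->
  margin 2 s < 0.
Proof.
move=> xyF xs ys r1; have xy := edge_neq xyF.
wlog : x y xyF xs ys xy / (index x s < index y s)%N => [wlg|].
  case: (ltngtP (index x s) (index y s)); first exact: wlg.
    by apply: wlg => //; rewrite 1?finset.setUC 1?eq_sym.
  by move=> eqi; rewrite -(nth_index x xs) eqi nth_index ?eqxx in xy.
elim: s xs ys => [|u s IH] //=.
case: (eqVneq u x) => [-> _|ux]; last first.
  rewrite inE eq_sym (negPf ux) /= inE; case: (eqVneq u y) => [-> |uy].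
    by [].

  rewrite /= => xs ys; rewrite ltnS => lt_xy.
  by rewrite -/(margin 2 (u :: s)) margin_cons gt_min IH ?orbT.
rewrite inE eq_sym (negPf xy) /= => ys _.
rewrite -/(margin 2 (x :: s)) margin_cons gt_min; apply/orP; left.
have : danger 2 (x :: s) <= -1.
  have /(danger_le 2 x) : [set y] \subset s by apply/subsetP => z; rewrite inE => /eqP ->.
  move=> /le_trans; apply; rewrite big_set1.
  have : (1 <= nedges (x |: [set y]))%N.
    rewrite card_gt0; apply/set0Pn; exists [set x; y].
    by rewrite inE xyF subxx.
  rewrite -(ler_nat R) => ?; have := cost_le1 2 s y; lra.
have : 2 <= r%:R :> R by rewrite ler_nat.
nra.
Qed.

Lemma margin_le0 th s : margin th s <= 0 ->
  exists t u s', s = t ++ u :: s' /\ 1 + r%:R * danger th (u :: s') <= 0.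
Proof.
elim: s => [|u s IH] /=; first by rewrite ler10.
rewrite ge_min => /orP[h|/IH[t [v [s' [-> h]]]]]; first by exists [::], u, s.
by exists (u :: t), v, s'.
Qed.

Lemma critical_exponent : F != finset.set0 -> (1 < r)%N -> exists th : R,
  [/\ 0 < th,
    exists2 s, perm_eq s (enum W) & 0 <= margin th s &
    forall s, perm_eq s (enum W) -> margin th s <= 0].
Proof.
move=> /set0Pn[e eF] r1.
have := subsetP hF e eF; rewrite inE => /cards2P[x [y [xy eE]]].
rewrite {}eE in eF.
(* [h] is minus the largest margin over the orderings, capped at 1; it is -1 at 0 and positive at 2,
   so it vanishes in between. *)
pose h th : R := \big[Num.min/1]_(s <- permutations (enum W)) - margin th s.
have hc : continuous (h : R^o -> R^o).
  by apply: continuous_bigmin => s th; apply: cvgN; exact: margin_continuous.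
have h0 : h 0 = -1.
  apply/le_anti/andP; split.
    apply: (@bigmin_inf_seq _ _ _ _ _ (enum W)); rewrite ?margin0 //.
    by rewrite mem_permutations.
  apply: le_bigmin => [|s _]; last by rewrite margin0.
  by rewrite (le_trans (lerN10 _)) // ler01.
have h2 : 0 < h 2.
  rewrite /h big_seq; apply: lt_bigmin => // s.
  rewrite mem_permutations => /perm_mem sW.
  by rewrite oppr_gt0 (margin2 eF) ?sW ?mem_enum.
have [|th] :=
    @IVT R h 0 2 0 (ler0n _ 2) (continuous_subspaceT hc).
  by rewrite ge_min le_max h0 (ltW h2) orbT lerN10.
rewrite in_itv /= => /andP[th0 th2] hth.
exists th; split.
- rewrite lt_def th0 andbT; apply/negP => /eqP th0'.
  by move: hth; rewrite th0' h0 => /eqP; rewrite oppr_eq0 oner_eq0.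
- have [/hasP[s]|/hasPn hlt] :=
      boolP (has (fun s => 0 <= margin th s) (permutations (enum W))).
    by rewrite mem_permutations; exists s.
  suff : 0 < h th by rewrite hth ltxx.
  rewrite /h big_seq; apply: lt_bigmin => // s /hlt.
  by rewrite -ltNge oppr_gt0.
- move=> s sW; rewrite -oppr_ge0 -hth.
  by apply: ge_bigmin_seq; rewrite ?mem_permutations.
Qed.

End Danger.
Arguments cost : simpl never.
Arguments danger : simpl never.
Arguments margin : simpl never.

(** * Above the threshold *)

Section WitnessTree.
Variables (R : realType) (W : finType) (F : {set {set W}}) (r : nat).
Implicit Types (s : seq W) (u x y : W).

(* The rounds of the structure forcing a copy of F, for s = u :: s' the vertices
   of F from youngest to oldest: the root is the round of u, and its r subtrees
   force the copies of F restricted to s' which the r vertices of the root round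
   would extend. *)
Fixpoint tree s : finType :=
  if s is _ :: s' then option ('I_r * tree s')%type else void.

Definition subtree u s (T : Type) (f : tree (u :: s) -> T) (j : 'I_r) :
  tree s -> T := fun z => f (Some (j, z)).

Fixpoint tree_size s : nat :=
  if s is _ :: s' then (r * tree_size s').+1 else 0.

(** Postorder: every subtree precedes its root, as older rounds must. *)
Fixpoint tree_rank s : tree s -> nat :=
  match s return tree s -> nat with
  | [::] => fun _ => 0%N
  | _ :: s' => fun n => if n is Some (j, n') then (j * tree_size s' + tree_rank n')%N
                        else (r * tree_size s')%N
  end.

(* Given the decisions d, the node whose selected vertex plays the role of x. *)
Fixpoint node s : (tree s -> 'I_r) -> W -> option (tree s) :=
  match s return (tree s -> 'I_r) -> W -> option (tree s) with
  | [::] => fun _ _ => None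
  | u :: s' => fun d x =>
      if x == u then Some None
      else omap (fun n => Some (d None, n)) (node (subtree d (d None)) x)
  end.

(* An edge is requested between vertex j of round n and the selected vertex of
   round m. *)
Fixpoint request s : (tree s -> 'I_r) -> tree s -> 'I_r -> tree s -> bool :=
  match s return (tree s -> 'I_r) -> tree s -> 'I_r -> tree s -> bool with
  | [::] => fun _ _ _ _ => false
  | u :: s' => fun d n j m =>
      match n, m with
      | None, Some (i, m') => (i == j) &&
          [exists x, ([set u; x] \in F) && (node (subtree d j) x == Some m')]
      | Some (i, n'), Some (i', m') =>
          (i == i') && request (subtree d i) n' j m'
      | _, None => false
      end
  end.

Lemma tree_rank_lt s (n : tree s) : (tree_rank n < tree_size s)%N.
Proof.
elim: s n => [|u s IH] [] //= [j n].
have := IH n; have := ltn_ord j.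
nia.
Qed.

Lemma tree_rank_inj s : injective (@tree_rank s).
Proof.
elim: s => [|u s IH] [] //=; last first.
- by case=> // -[j n] /= E; have := tree_rank_lt n; have := ltn_ord j; nia.
- move=> [i n] [[j m]|] /= E; last first.
    by have := tree_rank_lt n; have := ltn_ord i; nia.
  have nlt := tree_rank_lt n; have mlt := tree_rank_lt m.
  have ij : i = j by apply: val_inj => /=; nia.
  by rewrite -ij in E *; rewrite (IH n m) //; nia.
Qed.

Lemma request_rank s (d : tree s -> 'I_r) n j m :
  request d n j m -> (tree_rank m < tree_rank n)%N.
Proof.
elim: s d n m => [|u s IH] d // [[i n]|] [[i' m]|] //=.
  by case/andP => /eqP <- /IH; rewrite ltn_add2l.
by move=> _; have := tree_rank_lt m; have := ltn_ord i'; nia.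
Qed.

Lemma node_ext s (d d' : tree s -> 'I_r) x : d =1 d' -> node d x = node d' x.
Proof.
elim: s d d' => [|u s IH] d d' dd' //=; case: (x == u) => //.
by rewrite dd' (IH _ (subtree d' (d' None))) // => z; rewrite /subtree dd'.
Qed.

(** Requests made at n look only into the subtrees below n, hence at earlier decisions; this makes
    the requested edges adaptive. *)
Lemma request_ext s (d d' : tree s -> 'I_r) n j m :
  (forall k, (tree_rank k < tree_rank n)%N -> d k = d' k) ->
  request d n j m = request d' n j m.
Proof.
elim: s d d' n m => [|u s IH] d d' // [[i n]|] [[i' m]|] //= dd'.
  congr (_ && _); apply: IH => k lt_kn; apply: dd' => /=.
  by rewrite ltn_add2l.
congr (_ && _); apply: eq_existsb => x; congr (_ && (_ == _)).
apply: node_ext => k; apply: dd' => /=.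
by have := tree_rank_lt k; have := ltn_ord j; nia.
Qed.

Lemma node_some s (d : tree s -> 'I_r) x : x \in s -> node d x != None.
Proof.
elim: s d => [|u s IH] d //=; rewrite inE; case: (x == u) => //= xs.
by have := IH (subtree d (d None)) xs; case: node.
Qed.

Lemma node_mem s (d : tree s -> 'I_r) x n : node d x = Some n -> x \in s.
Proof.
elim: s d n => [|u s IH] d n //=; rewrite inE; case: (x == u) => //=.
by case E: node => [n'|] //= _; apply: IH E.
Qed.

Lemma node_inj s (d : tree s -> 'I_r) x y n :
  node d x = Some n -> node d y = Some n -> x = y.
Proof.
elim: s d n => [|u s IH] d n //=.
case: (eqVneq x u) => [->|_]; case: (eqVneq y u) => [->|_] //=.
- by move=> [<-]; case: node.
- by case: node => //= a [<-].
case Ex: node => [a|] //= [<-].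
case Ey: node => [b|] //= [ba].
by apply: IH Ex _; rewrite Ey ba.
Qed.

(** The node of the younger endpoint is the root of a subtree containing the other node, and it
    requested this edge for each of its r vertices, the selected one included. *)
Lemma node_request s (d : tree s -> 'I_r) x y n m : is_graph F -> [set x; y] \in F ->
  node d x = Some n -> node d y = Some m ->
  request d n (d n) m || request d m (d m) n.
Proof.
move=> hF xyF; have xy := edge_neq hF xyF; elim: s d n m => [|u s IH] d n m //=.
case: (eqVneq x u) => [xu|_]; case: (eqVneq y u) => [yu|_] //=.
- by rewrite xu yu eqxx in xy.
- move=> [<-]; case E: node => [m'|] //= [<-].
  rewrite eqxx /= orbF; apply/existsP; exists y.
  by rewrite -xu xyF E eqxx.
- case E: node => [m'|] //= [<-] [<-].
  rewrite eqxx /=; apply/existsP; exists x.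
  by rewrite -yu finset.setUC xyF E eqxx.
case Ex: node => [a|] //= [<-]; case Ey: node => [b|] //= [<-].
by rewrite eqxx /=; exact: IH.
Qed.

(** In the application [a] is the set of nodes on which two placements of the tree agree, and
    [requests] bounds the number of edges requested by both. *)
Definition volume s (a : pred (tree s)) : nat := \sum_(n : tree s) a n.

Definition requests s (d : tree s -> 'I_r) (a : pred (tree s)) : nat :=
  \sum_(n : tree s) \sum_(j : 'I_r) \sum_(m : tree s)
    [&& request d n j m, a n & a m].

Definition trace s (d : tree s -> 'I_r) (a : pred (tree s)) : {set W} :=
  [set x | oapp a false (node d x)].

Lemma sum_option (T : finType) (f : option T -> nat) :
  (\sum_(n : option T) f n = f None + \sum_(n : T) f (Some n))%N.
Proof.
rewrite (bigD1 None) //= (reindex_omap Some id) /=; last by case.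
by congr addn; apply: eq_bigl => n; rewrite eqxx.
Qed.

Lemma sum_tree u s (f : tree (u :: s) -> nat) :
  (\sum_(n : tree (u :: s)) f n =
   f None + \sum_(j : 'I_r) \sum_(n : tree s) f (Some (j, n)))%N.
Proof.
by rewrite sum_option pair_big /=; congr (_ + _)%N; apply: eq_bigr => -[].
Qed.

Lemma volume_cons u s (a : pred (tree (u :: s))) :
  volume a = (a None + \sum_(j : 'I_r) volume (subtree a j))%N.
Proof. exact: sum_tree. Qed.

(** A request either stays inside a subtree or goes from the root to a node of the copy traced in
    one subtree, that is, to a neighbor of u. *)
Lemma requests_cons u s (d : tree (u :: s) -> 'I_r) a :
  (requests d a <= \sum_(j : 'I_r) (requests (subtree d j) (subtree a j) +
     a None * #|[set x in trace (subtree d j) (subtree a j) | [set u; x] \in F]|))%N.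
Proof.
rewrite /requests sum_tree addnC big_split /=; apply: leq_add.
  apply: leq_sum => i _; apply: leq_sum => n _; apply: leq_sum => j _.
  rewrite sum_tree /= add0n (bigD1 i) //= eqxx /=.
  rewrite [X in (_ + X)%N]big1 ?addn0 //.
  by move=> i' /negPf ni; rewrite eq_sym ni big1.
apply: leq_sum => j _; rewrite sum_tree /= add0n (bigD1 j) //= eqxx /=.
rewrite [X in (_ + X)%N]big1 ?addn0; last first.
  by move=> i' /negPf ni; rewrite ni big1.
case: (a None) => /=; last by rewrite big1 // => m _; rewrite andbF.
rewrite mul1n.
set S := finset _.
(* The image of [S] under [g] covers all requested nodes in [a]; the value None for vertices without
   a node is harmless for an upper bound. *)
pose g x := odflt None (omap some (node (subtree d j) x)).
apply: leq_trans (leq_imset_card g S).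
rewrite -sum1_card [leqRHS]big_mkcond /= sum_option; apply: leq_trans (leq_addl _ _).
apply: leq_sum => m _.
case: existsP => [[x /andP[uxF /eqP xm]]|] //=; case: (boolP (a _)) => am //.
suff -> : (Some m \in g @: S) = true by [].
apply/imsetP; exists x; last by rewrite /g xm.
by rewrite !inE uxF xm /= /subtree am.
Qed.

Lemma trace_mem s (d : tree s -> 'I_r) a x : x \in trace d a -> x \in s.
Proof. by rewrite inE; case E: node => [n|] //= _; exact: node_mem E. Qed.

Lemma trace_cons u s (d : tree (u :: s) -> 'I_r) a : u \notin s ->
  trace d a = if a None then u |: trace (subtree d (d None)) (subtree a (d None))
              else trace (subtree d (d None)) (subtree a (d None)).
Proof.
move=> us; set T := trace (subtree _ _) _.
have uT : u \notin T by apply: contra us; exact: trace_mem.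
apply/setP => x; rewrite inE /=; case: (eqVneq x u) => [->|xu] /=.
  by case: (a None); rewrite ?setU11 ?(negPf uT).
have -> : (x \in (if a None then u |: T else T)) = (x \in T).
  by case: (a None); rewrite // !inE (negPf xu).
by rewrite inE; case: node.
Qed.

Definition surplus (th : R) s (d : tree s -> 'I_r) (a : pred (tree s)) : R :=
  (volume a)%:R - th * (requests d a)%:R.

(** Both bounds are proved together. If the root is in [a], each subtree contributes at least the
    danger, by the second bound for that subtree, and the total 1 + r danger is nonnegative by the
    margin. *)
Lemma surplus_ge th s (d : tree s -> 'I_r) a :
  is_graph F -> 0 <= th -> uniq s -> 0 <= margin F r th s ->
  0 <= surplus th d a /\
  \sum_(x in trace d a) cost F r th s x - th * (nedges F (trace d a))%:R <=
    surplus th d a.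
Proof.
move=> hF th0; elim: s d a => [|u s IH] d a.
  move=> _ _; rewrite /surplus /volume /requests !(big1 _ xpredT) => [|[]|[]].
  by rewrite mulr0 subr0 big1 // sub0r oppr_le0 mulr_ge0.
rewrite cons_uniq => /andP[us uns].
rewrite margin_cons le_min => /andP[ru0 /(IH _ _ uns) {}IH].
pose T j := trace (subtree d j) (subtree a j).
pose S j := surplus th (subtree d j) (subtree a j).
pose k j : nat := #|[set x in T j | [set u; x] \in F]|.
have uT j : u \notin T j by apply: contra us; exact: trace_mem.
have le_surplus :
    (a None)%:R + \sum_j (S j - th * (a None * k j)%:R) <= surplus th d a.
  have := requests_cons d a; rewrite -(ler_nat R) => le_req.
  have := ler_wpM2l th0 le_req; rewrite big_split /= natrD mulrDr => le_th.
  rewrite /surplus volume_cons natrD sumrB /S /surplus sumrB.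
  rewrite -!mulr_sumr -!natr_sum; lra.
(* The trace in subtree j competes in the minimum defining the danger. *)
have termge j : danger F r th (u :: s) <= S j - th * (k j)%:R.
  have Ts : T j \subset s by apply/subsetP => x; exact: trace_mem.
  have := danger_le F r th u Ts; have [_] := IH (subtree d j) (subtree a j).
  by rewrite nedgesU1 // natrD mulrDr -/(S j) -/(T j) -/(k j); lra.
have S0 j : 0 <= S j by have [] := IH (subtree d j) (subtree a j).
move: le_surplus; rewrite trace_cons //; set j0 := d None.
have costT : \sum_(x in T j0) cost F r th (u :: s) x =
    \sum_(x in T j0) cost F r th s x.
  apply: eq_bigr => x xT; rewrite cost_cons.
  by case: eqP => // xu; rewrite xu (negPf (uT _)) in xT.
case: (a None) => /= [|] le_surplus; last first.
  have le_sum : S j0 <= surplus th d a.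
    apply: le_trans le_surplus; rewrite add0r (bigD1 j0) //=.
    rewrite mul0n mulr0 subr0 lerDl sumr_ge0 // => j _.
    by rewrite subr0.
  split; first exact: le_trans le_sum.
  apply: le_trans le_sum; rewrite costT.
  by have [] := IH (subtree d j0) (subtree a j0).
split.
  apply: le_trans le_surplus; apply: le_trans ru0 _.
  rewrite lerD2l mulr_natl -[r in _ *+ r]card_ord -sumr_const.
  by apply: ler_sum => j _; rewrite mul1n.
apply: le_trans le_surplus; rewrite big_setU1; last exact: uT.
rewrite /= cost_cons eqxx costT.
rewrite nedgesU1 //; last exact: uT.
rewrite -/(T j0) -/(k j0) natrD mulrDr (bigD1 j0) //= mul1n.
(* The subtree [j0] continuing the copy is kept exactly; the other r - 1 are bounded by the danger
   and pay for the cost of u. *)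
have : r.-1%:R * danger F r th (u :: s) <=
    \sum_(j | j != j0) (S j - th * (1 * k j)%:R).
  have <- : #|[pred j | j != j0]| = r.-1 by rewrite cardC1 card_ord.
  rewrite mulr_natl -sumr_const; apply: ler_sum => j _.
  by rewrite mul1n.
have [_] := IH (subtree d j0) (subtree a j0); rewrite -/(S j0) -/(T j0).
lra.
Qed.

End WitnessTree.

(** * Decisions depend only on revealed edges *)

Section Strategy.
Variables (D : Type) (N r : nat) (st : strategy D N r).
Implicit Types (G H : graph N r) (e : {set vertex N r}).

Definition last_round e : nat := \max_(v in e) v.1.

Lemma last_round2 (v w : vertex N r) : last_round [set v; w] = maxn v.1 w.1.
Proof.
apply/eqP; rewrite eqn_leq; apply/andP; split.
  apply/bigmax_leqP => x; rewrite !inE => /orP[] /eqP ->.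
    exact: leq_maxl.
  exact: leq_maxr.
have mem x : x \in [set v; w] -> (x.1 <= last_round [set v; w])%N.
  by move=> xe; rewrite /last_round (bigD1 x) //= leq_maxl.
by rewrite geq_max !mem ?set21 ?set22.
Qed.

Lemma mem_revealed G k e :
  (e \in revealed G k.+1) = (e \in G) && (last_round e <= k)%N.
Proof.
rewrite inE; congr (_ && _); apply/forall_inP/bigmax_leqP => h v /h.
  by rewrite ltnS.
by rewrite ltnS.
Qed.

Lemma revealed_ext G H k :
  (forall e, (last_round e <= k)%N -> (e \in G) = (e \in H)) ->
  revealed G k.+1 = revealed H k.+1.
Proof.
move=> GH; apply/setP => e; rewrite !mem_revealed.
by case: leqP => [/GH ->|]; rewrite ?andbF.
Qed.

Lemma revealed_revealed G k K : (k <= K)%N ->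
  revealed (revealed G K) k = revealed G k.
Proof.
move=> kK; apply/setP => e; rewrite !inE -andbA; congr (_ && _).
apply/andP/idP => [[]//|h]; split=> //.
apply/forall_inP => v ve; apply: leq_trans kK.
exact: (forall_inP h).
Qed.

Lemma history_ext G H k : revealed G k = revealed H k ->
  history st G k = history st H k.
Proof.
elim: k => //= k IH GH.
have {}IH : history st G k = history st H k.
  by apply: IH; rewrite -(revealed_revealed G (leqnSn k)) GH revealed_revealed.
by rewrite GH IH.
Qed.

Lemma decision_ext G H k : revealed G k.+1 = revealed H k.+1 ->
  decision st G k = decision st H k.
Proof.
move=> GH; rewrite /decision GH (@history_ext G H k) //.
by rewrite -(revealed_revealed G (leqnSn k)) GH revealed_revealed.
Qed.

Lemma size_history G k : size (history st G k) = k.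
Proof. by elim: k => //= k IH; rewrite size_rcons IH. Qed.

Lemma nth_history x0 G i k : (i < k)%N ->
  nth x0 (history st G k) i = decision st G i.
Proof.
elim: k => //= k IH; rewrite ltnS leq_eqVlt nth_rcons size_history.
by case/orP => [/eqP ->|lt_ik]; rewrite ?ltnn ?eqxx // lt_ik IH.
Qed.

End Strategy.

(** * Second moment method against an arbitrary Achlioptas strategy *)

Section AchlioptasLoses.
Variables (R : realType) (W : finType) (F : {set {set W}}) (r N : nat).
Variables (s : seq W) (M : nat).
Hypotheses (hF : is_graph F) (us : uniq s) (hM : (tree_size r s * M <= N)%N).
Variable st : strategy 'I_r N r.
Implicit Types (G : graph N r) (phi : {ffun tree r s -> 'I_M}).

Fact place_proof phi (n : tree r s) : (tree_rank n * M + phi n < N)%N.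
Proof.
apply: leq_trans hM; have := tree_rank_lt n; have := ltn_ord (phi n); nia.
Qed.

(** Each node owns a block of M consecutive rounds and the blocks follow the rank, so every choice
    of phi respects the order of time. *)
Definition place phi n : 'I_N := Ordinal (place_proof phi n).

Lemma place_lt phi phi' n m : (tree_rank m < tree_rank n)%N ->
  (place phi' m < place phi n)%N.
Proof. by rewrite /=; have := ltn_ord (phi' m); nia. Qed.

Lemma place_inj phi phi' n m : place phi n = place phi' m ->
  n = m /\ phi n = phi' m.
Proof.
move=> /(congr1 val) /= E.
have M0 : (0 < M)%N by case: M (phi n) => // -[].
have := congr1 (divn^~ M) E; rewrite !divnMDl // !divn_small // !addn0.
move=> /(@tree_rank_inj W r s) nm; split=> //; apply: val_inj => /=.
by rewrite nm in E *; apply: addnI E.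
Qed.

Definition decisions phi G (n : tree r s) : 'I_r := decision st G (place phi n).

Definition requested phi G : graph N r :=
  [set e | [exists n, exists j, exists m,
     request F (decisions phi G) n j m &&
     (e == [set (place phi n, j); (place phi m, decisions phi G m)])]].

Lemma requestedP phi G e :
  reflect (exists n j m, request F (decisions phi G) n j m /\
             e = [set (place phi n, j); (place phi m, decisions phi G m)])
          (e \in requested phi G).
Proof.
rewrite inE; apply: (iffP existsP).
  by move=> [n /existsP[j /existsP[m /andP[h /eqP ->]]]]; exists n, j, m.
move=> [n [j [m [h ->]]]]; exists n; apply/existsP; exists j.
by apply/existsP; exists m; rewrite h eqxx.
Qed.

Lemma decisions_ext phi G G' n k : (place phi n <= k)%N ->
  (forall e, (last_round e <= k)%N -> (e \in G) = (e \in G')) ->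
  decisions phi G n = decisions phi G' n.
Proof.
move=> nk GG'; apply: decision_ext; apply: revealed_ext => e le_e.
by apply: GG'; apply: leq_trans nk.
Qed.

Lemma last_round_request phi G n j m c : request F (decisions phi G) n j m ->
  last_round [set (place phi n, j); (place phi m, c)] = place phi n.
Proof.
move=> /request_rank /(place_lt phi phi) lt_mn; rewrite last_round2.
by apply/maxn_idPl/ltnW.
Qed.

Lemma requested_adaptive phi : adaptive (@last_round N r) (requested phi).
Proof.
suff sub G G' e : (forall e', (last_round e' < last_round e)%N ->
      (e' \in G) = (e' \in G')) ->
    e \in requested phi G -> e \in requested phi G'.
  move=> G G' e GG'; apply/idP/idP; apply: sub => // e' lt_e'.
  by rewrite GG'.
move=> GG' /requestedP[n [j [m [h eE]]]].
have le_e : last_round e = place phi n by rewrite eE; exact: last_round_request h.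
have dE k : (tree_rank k < tree_rank n)%N ->
    decisions phi G k = decisions phi G' k.
  move=> /(place_lt phi phi) lt_kn.
  apply: (@decisions_ext phi G G' k (place phi n).-1) => [|e' le_e'].
    by case: (place phi n : nat) lt_kn => //.
  by apply: GG'; rewrite le_e; case: (place phi n : nat) lt_kn le_e'.
apply/requestedP; exists n, j, m; split.
  by rewrite -(request_ext F j m dE).
by rewrite eE dE // (request_rank h).
Qed.

Lemma requested_sub phi G : requested phi G \subset pairs (vertex N r).
Proof.
apply/subsetP => e /requestedP[n [j [m [/request_rank h ->]]]].
rewrite inE cards2; case: (eqVneq (place phi n, j)) => [/(congr1 fst) nm|//].
by have := place_lt phi phi h; rewrite [place phi n]nm ltnn.
Qed.

(** A common edge has the same two rounds in both placements. As the blocks are disjoint, these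
    determine its two nodes, on which the placements then agree. *)
Lemma requested_overlap phi phi' G :
  (#|requested phi G :&: requested phi' G| <=
   requests F (decisions phi G) (fun n => phi n == phi' n))%N.
Proof.
set d := decisions phi G; set a := fun n => _.
pose S := [set x : tree r s * 'I_r * tree r s |
            [&& request F d x.1.1 x.1.2 x.2, a x.1.1 & a x.2]].
pose g (x : tree r s * 'I_r * tree r s) : {set vertex N r} :=
  [set (place phi x.1.1, x.1.2); (place phi x.2, d x.2)].
have -> : requests F d a = #|S|.
  rewrite /requests -sum1_card pair_big pair_big /= [RHS]big_mkcond /=.
  by apply: eq_bigr => -[[n j] m] _; rewrite inE /=; case: [&& _, _ & _].
apply: leq_trans (leq_imset_card g S); apply/subset_leq_card/subsetP => e.
rewrite inE => /andP[/requestedP[n [j [m [h eE]]]] /requestedP[n' [j' [m' [h' eE']]]]].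
have nn : place phi n = place phi' n'.
  apply: ord_inj; rewrite -(last_round_request (decisions phi G m) h).
  by rewrite -(last_round_request (decisions phi' G m') h') -eE -eE'.
have mn := place_lt phi phi (request_rank h).
have mm : place phi m = place phi' m'.
  have : (place phi m, decisions phi G m) \in e by rewrite eE set22.
  rewrite eE' !inE => /orP[] /eqP /(congr1 fst) mn' //.
  have {}mn' : place phi m = place phi' n' := mn'.
  by rewrite mn' -nn ltnn in mn.
have [nn1 nn2] := place_inj nn; have [mm1 mm2] := place_inj mm.
apply/imsetP; exists (n, j, m); last by rewrite eE.
by rewrite inE /= h /a nn2 mm2 nn1 mm1 !eqxx.
Qed.

Lemma requested_copy phi G : perm_eq s (enum W) -> requested phi G \subset G ->
  has_copy F G (achlioptas_selected st G).
Proof.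
move=> sW sub; set d := decisions phi G.
have mem x : x \in s by rewrite (perm_mem sW) mem_enum.
have nodeP x : {n | node d x = Some n}.
  by have := node_some d (mem x); case: node => // n _; exists n.
pose f := [ffun x => (place phi (sval (nodeP x)), d (sval (nodeP x)))].
apply/existsP; exists f; apply/and3P; split.
- apply/injectiveP => x y; rewrite !ffunE => /(congr1 fst) /place_inj[xy _].
  by apply: (node_inj (svalP (nodeP x))); rewrite xy; exact: svalP (nodeP y).
- by apply/forallP => x; rewrite ffunE inE.
apply/forall_inP => e eF; apply: (subsetP sub).
have := subsetP hF e eF; rewrite inE => /cards2P[x [y [xy eE]]].
rewrite {e}eE in eF *; rewrite imsetU1 imset_set1 !ffunE.
apply/requestedP.
have [h|h] := orP (node_request hF eF (svalP (nodeP x)) (svalP (nodeP y))).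
  by exists (sval (nodeP x)), (d (sval (nodeP x))), (sval (nodeP y)).
exists (sval (nodeP y)), (d (sval (nodeP y))), (sval (nodeP x)).
by rewrite finset.setUC.
Qed.

Variables (p th L kappa delta : R).
Hypotheses (p0 : 0 < p) (p1 : p <= 1) (th0 : 0 < th) (M0 : (0 < M)%N).
Hypotheses (sW : perm_eq s (enum W)) (hs : 0 <= margin F r th s).
Hypotheses (L0 : 0 <= L) (LM : L <= kappa * M%:R) (k1 : 1 <= kappa) (d0 : 0 <= delta).
Hypothesis hL : forall q v : nat, (0 < v)%N -> th * q%:R <= v%:R ->
  (p ^+ q)^-1 <= L ^+ v * delta.

(** Counts the placements whose requests are all present, each normalized to have mean 1. *)
Let Z G : R := \sum_phi (requested phi G \subset G)%:R / p ^+ #|requested phi G|.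

Let T := #|tree r s|.

Lemma mean_witnesses : gnp_mean p Z = M%:R ^+ T.
Proof.
rewrite /gnp_mean /Z; under eq_bigr do rewrite mulr_sumr.
rewrite exchange_big /= -natrX.
transitivity (\sum_(phi : {ffun tree r s -> 'I_M}) (1 : R)); last first.
  by rewrite sumr_const card_ffun card_ord.
apply: eq_bigr => phi _.
apply: (adaptive_mean (@requested_adaptive phi) (requested_sub phi)).
by rewrite gt_eqF.
Qed.

Let agree phi phi' : {set tree r s} := [set n | phi n == phi' n].

Let pair_bound (A : {set tree r s}) : R :=
  if A == finset.set0 then 1 else L ^+ #|A| * delta.

(** By [surplus_ge] the agreeing nodes number at least th times the common edges, so [hL] applies;
    without agreeing nodes there is no common edge. *)
Lemma overlap_bound phi phi' G :
  (p ^+ #|requested phi G :&: requested phi' G|)^-1 <= pair_bound (agree phi phi').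
Proof.
set q := #|_|; set d := decisions phi G.
have qle : (q <= requests F d (fun n => phi n == phi' n))%N.
  exact: requested_overlap.
have [+ _] := surplus_ge d (fun n => phi n == phi' n) hF (ltW th0) us hs.
rewrite /surplus subr_ge0 => le_vol.
have volE : volume (fun n => phi n == phi' n) = #|agree phi phi'|.
  rewrite /volume -sum1_card [RHS]big_mkcond /=; apply: eq_bigr => n _.
  by rewrite inE; case: eqP.
have {le_vol qle} thq : th * q%:R <= #|agree phi phi'|%:R.
  rewrite -volE; apply: le_trans le_vol.
  by rewrite ler_pM2l // ler_nat.
rewrite /pair_bound; case: eqP => [A0|/eqP A0]; last first.
  by apply: hL => //; rewrite card_gt0.
move: thq; rewrite A0 cards0 pmulr_rle0 // lern0 => /eqP ->.
by rewrite expr0 invr1.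
Qed.

(** The union of both requests is again adaptive and has normalized mean 1; the two normalizations
    differ by the overlap. *)
Lemma mean_pair phi phi' :
  gnp_mean p (fun G => (requested phi G \subset G)%:R / p ^+ #|requested phi G| *
    ((requested phi' G \subset G)%:R / p ^+ #|requested phi' G|)) <=
  pair_bound (agree phi phi').
Proof.
set K := pair_bound _.
pose U G := requested phi G :|: requested phi' G.
have <- : gnp_mean p (fun G => (U G \subset G)%:R / p ^+ #|U G|) * K = K.
  rewrite (adaptive_mean (adaptiveU (@requested_adaptive phi)
    (@requested_adaptive phi'))) ?mul1r //; last by rewrite gt_eqF.
  by move=> G; rewrite subUset; apply/andP; split; exact: requested_sub.
rewrite /gnp_mean mulr_suml; apply: ler_sum => G _.
rewrite -[leRHS]mulrA ler_wpM2l ?weight_ge0 ?(ltW p0) //.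
rewrite /U subUset; set B := requested phi G; set B' := requested phi' G.
have key (b b' : bool) (x y z k : R) : x * y <= z * k ->
    b%:R * x * (b'%:R * y) <= (b && b')%:R * z * k.
  by case: b; case: b'; rewrite /= ?mulr0n ?mulr1n ?mul1r ?mul0r ?mulr0 ?mul0r.
apply: key.
have -> : (p ^+ #|B|)^-1 * (p ^+ #|B'|)^-1 =
    (p ^+ #|B :|: B'|)^-1 * (p ^+ #|B :&: B'|)^-1.
  by rewrite -!invfM -!exprD cardsUI.
by rewrite ler_wpM2l ?overlap_bound // invr_ge0 exprn_ge0 // ltW.
Qed.

Lemma card_agree phi (A : {set tree r s}) :
  (#|[pred phi' | agree phi phi' == A]| <= M ^ (T - #|A|))%N.
Proof.
pose Q n : pred 'I_M := if n \in A then pred1 (phi n) else predT.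
apply: (@leq_trans #|family Q|).
  apply/subset_leq_card/subsetP => phi' aA.
  have {aA} AE : agree phi phi' = A by exact/eqP.
  apply/familyP => n; rewrite /Q -AE inE; case: eqP => // ->.
  by rewrite unfold_in /= eqxx.
rewrite card_family foldrE big_map big_enum /=.
rewrite (bigID (mem A)) /= big1 ?mul1n; last first.
  by move=> n nA; rewrite /Q nA card1.
rewrite (eq_bigr (fun=> M)); last first.
  by move=> n /negPf nA; rewrite /Q nA card_ord.
rewrite prod_nat_const leq_pexp2l //.
by rewrite /T -(cardC (mem A)) addKn.
Qed.

(** Pairs are grouped by their agreement set A. The empty set gives the squared mean; each of the at
    most 2 ^ T others is smaller by the factor delta, up to kappa ^ T. *)
Lemma mean_witnesses_sqr : gnp_mean p (fun G => Z G ^+ 2) <=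
  M%:R ^+ T * (M%:R ^+ T + (2 * kappa) ^+ T * M%:R ^+ T * delta).
Proof.
have -> : gnp_mean p (fun G => Z G ^+ 2) = \sum_phi \sum_phi'
   gnp_mean p (fun G => (requested phi G \subset G)%:R / p ^+ #|requested phi G| *
    ((requested phi' G \subset G)%:R / p ^+ #|requested phi' G|)).
  rewrite /gnp_mean; under [RHS]eq_bigr do rewrite exchange_big /=.
  rewrite exchange_big /=; apply: eq_bigr => G _.
  rewrite expr2 /Z mulr_suml mulr_sumr; apply: eq_bigr => phi _.
  by rewrite mulr_sumr mulr_sumr.
have kM0 : 0 <= kappa * M%:R by exact: le_trans LM.
have row phi : \sum_phi' pair_bound (agree phi phi') <=
    M%:R ^+ T + (2 * kappa) ^+ T * M%:R ^+ T * delta.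
  rewrite (partition_big (agree phi) xpredT) //= (bigD1 finset.set0) //=.
  have sumA A : \sum_(phi' | agree phi phi' == A) pair_bound (agree phi phi') <=
      M%:R ^+ (T - #|A|) * pair_bound A.
    rewrite (eq_bigr (fun=> pair_bound A)); last by move=> phi' /eqP ->.
    rewrite sumr_const -[leLHS]mulr_natl ler_wpM2r //.
      by rewrite /pair_bound; case: ifP => // _; rewrite mulr_ge0 // exprn_ge0.
    by rewrite -natrX ler_nat; exact: card_agree.
  apply: lerD.
    by apply: le_trans (sumA _) _; rewrite cards0 subn0 /pair_bound eqxx mulr1.
  apply: (@le_trans _ _ (\sum_(A : {set tree r s}) kappa ^+ T * M%:R ^+ T * delta)).
    rewrite big_mkcond /=; apply: ler_sum => A _.
    have rhs0 : 0 <= kappa ^+ T * M%:R ^+ T * delta.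
      by rewrite -exprMn mulr_ge0 // exprn_ge0.
    case: ifP => // /negPf A0; apply: le_trans (sumA _) _.
    rewrite /pair_bound A0 mulrA ler_wpM2r //.
    have AT : (#|A| <= T)%N by exact: max_card.
    have -> : kappa ^+ T * M%:R ^+ T =
        M%:R ^+ (T - #|A|) * (kappa ^+ T * M%:R ^+ #|A|).
      by rewrite mulrCA -exprD subnK.
    rewrite ler_wpM2l ?exprn_ge0 //.
    apply: (@le_trans _ _ ((kappa * M%:R) ^+ #|A|)).
      by rewrite lerXn2r ?nnegrE.
    by rewrite exprMn ler_wpM2r ?exprn_ge0 // ler_weXn2l.
  rewrite sumr_const -[leLHS]mulr_natl exprMn -!mulrA ler_wpM2r //.
    by rewrite mulrA -exprMn mulr_ge0 // exprn_ge0.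
  rewrite -natrX ler_nat /T -cardsT -card_powerset.
  by apply/subset_leq_card/subsetP => A _; rewrite powersetE subsetT.
apply: (@le_trans _ _ (\sum_(phi : {ffun tree r s -> 'I_M})
    (M%:R ^+ T + (2 * kappa) ^+ T * M%:R ^+ T * delta))).
  apply: ler_sum => phi _; apply: le_trans (row phi).
  by apply: ler_sum => phi' _; exact: mean_pair.
by rewrite sumr_const card_ffun card_ord -[leLHS]mulr_natl natrX.
Qed.

Lemma achlioptas_win_prob :
  gnp_prob p (achlioptas_wins F st) <= (2 * kappa) ^+ T * delta.
Proof.
have Z0 G : is_graph G -> achlioptas_wins F st G -> Z G = 0.
  move=> _ win; rewrite /Z big1 // => phi _.
  case: (boolP (requested phi G \subset G)) => [sub|]; last by rewrite mul0r.
  by rewrite /achlioptas_wins (requested_copy sW sub) in win.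
have p01 : 0 <= p <= 1 by rewrite ltW.
have := chebyshev0 p01 Z0; rewrite mean_witnesses.
have := mean_witnesses_sqr; set m := M%:R ^+ T; set c := _ ^+ T.
have m0 : 0 < m by rewrite exprn_gt0 // ltr0n.
move=> h1 h2; have m20 : 0 < m ^+ 2 by rewrite exprn_gt0.
rewrite -(ler_pM2r m20); apply: le_trans h2 _.
rewrite lerBlDr; apply: le_trans h1 _.
by rewrite le_eqVlt; apply/orP; left; apply/eqP; ring.
Qed.

End AchlioptasLoses.

(** * Below the threshold *)

(* The permutation is chosen lexicographically best: if the rows reachable from j
   by improving exchanges reached column [sigma j], rotating along the resulting
   cycle would improve it; otherwise these rows and the columns outside their
   image form an s x (r + 1 - s) block of entries at most D j (sigma j). *)
Lemma balanced_assignment (R : realDomainType) (r : nat) (D : 'I_r -> 'I_r -> R) :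
  exists sigma : {perm 'I_r}, forall j, exists B : {set 'I_r * 'I_r},
    [/\ (j, sigma j) \in B, (r <= #|B|)%N &
        forall b, b \in B -> D b.1 b.2 <= D j (sigma j)].
Proof.
(* Small entries are the bad ones and have high rank; the base r + 1 makes one entry of rank k
   outweigh r entries of lower rank. *)
pose rk i c := #|[set y : 'I_r * 'I_r | D i c < D y.1 y.2]|.
have rk_lt i c i' c' : D i c < D i' c' -> (rk i' c' < rk i c)%N.
  move=> lt; apply/proper_card/properP; split.
    by apply/subsetP => y; rewrite !inE; exact: lt_trans.
  by exists (i', c'); rewrite inE //= ltxx.
pose Phi (sigma : {perm 'I_r}) := (\sum_i r.+1 ^ rk i (sigma i))%N.
have [sigma _ min_sigma] := @arg_minnP _ (1%g : {perm 'I_r}) xpredT Phi isT.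
exists sigma => j; set b := D j (sigma j).
(* Row i would improve on [b] by taking over the column of row k. *)
pose e : rel 'I_r := fun i k => b < D i (sigma k).
pose S := [set i | connect e j i].
have jS : j \in S by rewrite inE connect0.
have [/exists_inP[a aS eaj]|noS] := boolP [exists a in S, e a j].
  exfalso; move: aS; rewrite inE => /connectP[p0 ep0 a_last].
  move: eaj; rewrite a_last; case: (shortenP ep0) => p ep up _ eaj.
  (* The edge back to j closes a cycle; [tau] gives each of its rows the column of its successor, so
     all new entries on it exceed [b]. *)
  pose c := j :: p.
  have cyc : path.cycle e c by rewrite /= rcons_path ep.
  pose tau := perm (can_inj (prev_next up)).
  have := min_sigma (tau * sigma)%g isT; apply/negP; rewrite -ltnNge.
  have tauE i : (tau * sigma)%g i = sigma (next c i) by rewrite permM permE.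
  rewrite /Phi (bigID (mem c)) [X in (_ < X)%N](bigID (mem c)) /= -addSn.
  apply: leq_add; last first.
    apply/eq_leq/eq_bigr => i ic; rewrite tauE.
    by rewrite next_nth (negPf ic).
  rewrite [X in (_ < X)%N](bigD1 j) ?mem_head //=.
  apply: leq_trans (leq_addr _ _).
  set k := rk j (sigma j).
  have lt_k i : i \in c -> (rk i ((tau * sigma)%g i) < k)%N.
    by move=> ic; rewrite tauE; apply: rk_lt; exact: next_cycle cyc ic.
  have k0 : (0 < k)%N by apply: leq_ltn_trans (lt_k j (mem_head _ _)).
  apply: (@leq_ltn_trans (r * r.+1 ^ k.-1)).
    apply: (@leq_trans (\sum_(i in c) r.+1 ^ k.-1)%N).
      apply: leq_sum => i ic; rewrite leq_pexp2l //.
      by rewrite -ltnS prednK // lt_k.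
    rewrite sum_nat_const leq_mul2r; apply/orP; right.
    by rewrite -[leqRHS]card_ord max_card.
  by rewrite -{2}(prednK k0) expnS ltn_pmul2r // expn_gt0.
have {noS} noS a : a \in S -> D a (sigma j) <= b.
  move=> aS; rewrite leNgt; apply/negP => eaj.
  by move/negP: noS; apply; apply/exists_inP; exists a.
have closedS a k : a \in S -> k \notin S -> D a (sigma k) <= b.
  move=> aS kS; rewrite leNgt; apply: contra kS => eak.
  by move: aS; rewrite !inE => /connect_trans; apply; exact: connect1.
pose C := sigma @: (~: (S :\ j)).
exists (setX S C); split.
- by rewrite in_setX jS imset_f // !inE eqxx.
- have cS : #|S :\ j|.+1 = #|S| by rewrite (cardsD1 j S) jS.
  have := cardsC (S :\ j); rewrite card_ord.
  rewrite cardsX card_imset; last exact: perm_inj.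
  have z0 : (0 < #|~: (S :\ j)|)%N.
    by apply/card_gt0P; exists j; rewrite !inE eqxx.
  move: cS z0; move: #|S| #|S :\ j| #|~: (S :\ j)| => x y z; nia.
- move=> [a k]; rewrite in_setX /= => /andP[aS /imsetP[i + ->]].
  rewrite !inE negb_and negbK => /orP[/eqP ->|iS]; first exact: noS.
  by apply: closedS => //; rewrite inE.
Qed.

Lemma pairwise_inj (T : eqType) (g : T -> nat) (s : seq T) :
  pairwise (fun x y => g y < g x)%N s -> {in s &, injective g}.
Proof.
elim: s => //= x s IH /andP[/allP gx /IH inj] y z; rewrite !inE.
case/orP => [/eqP ->|ys] /orP[/eqP ->|zs] // gyz.
- by have := gx z zs; rewrite gyz ltnn.
- by have := gx y ys; rewrite gyz ltnn.
- exact: inj.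
Qed.

(** * Structures explaining the decisions of the Ramsey player *)

Section WitnessStructures.
Variables (R : realType) (W : finType) (F : {set {set W}}) (r N : nat).
Hypothesis hF : is_graph F.
Variables (G : graph N r) (col : vertex N r -> 'I_r) (th : R).
Implicit Types (i : 'I_N) (j c : 'I_r) (s : seq W) (T : {set 'I_N}).
Implicit Types (E : graph N r) (e : {set vertex N r}) (f : {ffun W -> vertex N r}).

Definition rounds E : {set 'I_N} := [set i | [exists e in E, [exists v in e, v.1 == i]]].

Lemma roundsP E i : reflect (exists e v, [/\ e \in E, v \in e & v.1 = i]) (i \in rounds E).
Proof.
rewrite inE; apply: (iffP exists_inP) => [[e eE /exists_inP[v ve /eqP vi]]|].
  by exists e, v.
move=> [e [v [eE ve vi]]]; exists e => //; apply/exists_inP; exists v => //.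
exact/eqP.
Qed.

(** The exponent of the expected number of such structures at p = n ^ (- th). *)
Definition excess T E : R := #|T|%:R - th * #|E|%:R.

(** The only property of the random graph used below the threshold. *)
Definition sparse C : Prop := forall E, E \subset G -> E != finset.set0 ->
  (#|E| <= C)%N -> th * #|E|%:R < #|rounds E|%:R.

Section Excess.
Variables (C : nat) (hG : sparse C).

Lemma excess_ge0 T E : E \subset G -> rounds E \subset T -> (#|E| <= C)%N ->
  0 <= excess T E.
Proof.
move=> EG ET EC; rewrite /excess subr_ge0.
have [->|E0] := eqVneq E finset.set0; first by rewrite cards0 mulr0.
apply: le_trans (ltW (hG EG E0 EC)) _.
by rewrite ler_nat subset_leq_card.
Qed.

Lemma excess_gt0 T E i : E \subset G -> rounds E \subset T -> (#|E| <= C)%N ->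
  i \in T -> 0 < excess T E.
Proof.
move=> EG ET EC iT; rewrite /excess subr_gt0.
have [->|E0] := eqVneq E finset.set0.
  by rewrite cards0 mulr0 ltr0n; apply/card_gt0P; exists i.
apply: lt_le_trans (hG EG E0 EC) _.
by rewrite ler_nat subset_leq_card.
Qed.

(** Inclusion-exclusion: no common edge touches round i, so the intersection without i still has
    nonnegative excess, and i accounts for the 1. *)
Lemma excess_glue T1 E1 T2 E2 i :
  E1 \subset G -> rounds E1 \subset T1 -> rounds E2 \subset T2 -> (#|E2| <= C)%N ->
  i \in T1 -> i \in T2 -> i \notin rounds (E1 :&: E2) ->
  excess (T1 :|: T2) (E1 :|: E2) <= excess T1 E1 + excess T2 E2 - 1.
Proof.
move=> E1G ET1 ET2 E2C i1 i2 iE.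
have iT : i \in T1 :&: T2 by rewrite inE i1.
have : 0 <= excess ((T1 :&: T2) :\ i) (E1 :&: E2).
  apply: excess_ge0.
  - exact: subset_trans (subsetIl _ _) E1G.
  - apply/subsetP => k kE; rewrite in_setD1; apply/andP; split.
      by apply: contraNneq iE => <-.
    have /roundsP[e [v [+ ve vk]]] := kE; rewrite inE => /andP[e1 e2].
    rewrite inE (subsetP ET1) ?(subsetP ET2) //.
      by apply/roundsP; exists e, v.
    by apply/roundsP; exists e, v.
  - exact: leq_trans (subset_leq_card (subsetIr _ _)) E2C.
have cT : (#|T1| + #|T2|)%:R = #|T1 :|: T2|%:R + #|(T1 :&: T2) :\ i|%:R + 1 :> R.
  by rewrite -cardsUI (cardsD1 i (T1 :&: T2)) iT add1n natrD -natr1 addrA.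
have cE : (#|E1| + #|E2|)%:R = #|E1 :|: E2|%:R + #|E1 :&: E2|%:R :> R.
  by rewrite -natrD cardsUI.
rewrite /excess !natrD in cT cE *.
have -> : #|T1|%:R - th * #|E1|%:R + (#|T2|%:R - th * #|E2|%:R) - 1 =
    (#|T1|%:R + #|T2|%:R) - th * (#|E1|%:R + #|E2|%:R) - 1 by ring.
rewrite cT cE; lra.
Qed.

End Excess.

Lemma rounds_union E1 E2 T1 T2 : rounds E1 \subset T1 -> rounds E2 \subset T2 ->
  rounds (E1 :|: E2) \subset T1 :|: T2.
Proof.
move=> h1 h2; apply/subsetP => i /roundsP[e [v [+ ve vi]]].
rewrite !inE => /orP[eE|eE].
  by rewrite (subsetP h1) //; apply/roundsP; exists e, v.
by rewrite (subsetP h2) ?orbT //; apply/roundsP; exists e, v.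
Qed.

Definition back_edge i j c e : bool :=
  [exists y : vertex N r, [&& e == [set (i, j); y], (y.1 < i)%N & col y == c]].

(** Hence branches for different pairs share no edge at round i. *)
Lemma back_edge_inj i j c j' c' e :
  back_edge i j c e -> back_edge i j' c' e -> (j, c) = (j', c').
Proof.
move=> /existsP[y /and3P[/eqP -> yi /eqP <-]].
move=> /existsP[y' /and3P[/eqP /setP E yi' /eqP <-]].
have := E (i, j); rewrite !inE eqxx /= => /esym/orP[/eqP[->]|/eqP y'E]; last first.
  by rewrite -y'E ltnn in yi'.
have := E y; rewrite !inE eqxx orbT /= => /esym/orP[/eqP y'E|/eqP -> //].
by rewrite y'E ltnn in yi.
Qed.

(** The color of (i, j) itself is left free. The empty list is always completed, so every pair (j,
    c) completes some list. *)
Definition completes i j c s f : bool :=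
  if s is u :: s' then
    [&& f u == (i, j), all (fun x => col (f x) == c) s', uniq s,
        pairwise (fun x y => (f y).1 < (f x).1)%N s &
        [forall e in F, (e \subset s) ==> (f @: e \in G)]]
  else true.

Definition structure i T E : Prop :=
  [/\ E \subset G, rounds E \subset T, i \in T & forall t, t \in T -> (t <= i)%N].

Lemma structure1 i : structure i [set i] finset.set0.
Proof.
split; rewrite ?sub0set ?set11 //; last by move=> t /set1P ->.
by apply/subsetP => k /roundsP[e [v [+ _ _]]]; rewrite inE.
Qed.

Variables (m K : nat) (eps : R).

(* The size bounds satisfy the recursion of the construction: an item is r ^ 2
   branches at most, and a branch is at most m items with a smaller index. *)
Fixpoint size_bound (t : nat) : nat :=
  if t is t'.+1 then (r ^ 2 * (#|F| + m * size_bound t'))%N else 0.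

Lemma size_bound_mono t t' : (t <= t')%N -> (size_bound t <= size_bound t')%N.
Proof.
elim: t t' => [|t IH] [|t'] //= tt'.
by rewrite leq_mul2l leq_add2l leq_mul2l IH ?orbT.
Qed.

Definition branch_bound (t : nat) := (#|F| + m * size_bound t)%N.

Lemma branch_bound_mono t t' : (t <= t')%N -> (branch_bound t <= branch_bound t')%N.
Proof. by move=> tt'; rewrite leq_add2l leq_mul2l size_bound_mono ?orbT. Qed.

(* An item explains why (i, j) was selected although it completed s, a branch how
   (i, j) completes s in color c; k counts the strict drops of danger on the way. *)
Definition item i j s : Prop := exists k T E, [/\
  structure i T E,
  (forall e v, e \in E -> v \in e -> v.1 = i -> ~~ back_edge i j (col (i, j)) e),
  excess T E <= 1 + r.-1%:R * danger F r th s - eps * k%:R,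
  (#|E| <= size_bound (k * m.+1 + size s))%N & (k <= K)%N].

Definition branch i j c s : Prop := exists k T E, [/\
  structure i T E,
  (forall e v, e \in E -> v \in e -> v.1 = i -> back_edge i j c e),
  excess T E <= 1 + danger F r th s - eps * k%:R,
  (#|E| <= branch_bound (k * m.+1 + (size s).-1))%N & (k <= m * K)%N].

Hypothesis Wm : (#|W| <= m)%N.

Lemma uniq_size s : uniq s -> (size s <= m)%N.
Proof.
move=> us; apply: leq_trans Wm; rewrite -(card_uniqP us).
exact: max_card.
Qed.

Variables (C : nat).
Hypotheses (hG : sparse C) (hC : (size_bound (K * m.+1 + m) <= C)%N).

(** For J attaining the danger, the copy of F on [u |: J] has excess 1 + #|J| - th times its edges;
    gluing on the item of each x in J adds cost - 1. *)
Lemma branch_of_items i j c s f :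
  (forall i' j' s' f', (i' < i)%N -> completes i' j' (col (i', j')) s' f' ->
     s' != [::] -> item i' j' s') ->
  completes i j c s f -> branch i j c s.
Proof.
case: s => [|u s] items.
  move=> _; exists 0%N, [set i], finset.set0; split.
  - exact: structure1.
  - by move=> e v; rewrite inE.
  - by rewrite /excess cards0 cards1 /danger !mulr0 !subr0 addr0.
  - by rewrite cards0.
  - by [].
move=> /and5P[/eqP fu /allP colf usu pw /forall_inP edges].
have [us_u us] : u \notin s /\ uniq s by apply/andP.
have [/allP fsu pws] :
  all (fun y => (f y).1 < (f u).1)%N s /\ pairwise (fun x y => (f y).1 < (f x).1)%N s.
  by apply/andP.
have f_lt_i x : x \in s -> ((f x).1 < i)%N by move=> /fsu; rewrite fu.
have f_inj : {in u :: s &, injective (fun x => (f x).1 : nat)} by exact: pairwise_inj.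
have [J Js dE] := danger_attained r hF th u s.
have uJ : u \notin J by apply: contra us_u; exact: (subsetP Js).
have Jus : u |: J \subset u :: s.
  apply/subsetP => x; rewrite !inE => /orP[->//|/(subsetP Js) ->].
  by rewrite orbT.
pose F0 := [set e in F | e \subset u |: J].
pose E0 : graph N r := [set f @: (e : {set W}) | e in F0].
pose T0 : {set 'I_N} := i |: [set (f x).1 | x in J].
have E0G : E0 \subset G.
  apply/subsetP => _ /imsetP[e + ->]; rewrite inE => /andP[eF eJ].
  by have := edges e eF; rewrite (subset_trans eJ Jus).
have E0T : rounds E0 \subset T0.
  apply/subsetP => k /roundsP[_ [_ [/imsetP[e + ->] /imsetP[x xe ->] <-]]].
  rewrite inE => /andP[_ /subsetP /(_ x xe)] /setU1P[->|xJ].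
    by rewrite fu setU11.
  by rewrite setU1r // (imset_f (fun x => (f x).1)).
have T0i t : t \in T0 -> (t <= i)%N.
  case/setU1P => [->//|/imsetP[x /(subsetP Js) xs ->]].
  exact/ltnW/f_lt_i.
have ex0 : excess T0 E0 = 1 + #|J|%:R - th * (nedges F (u |: J))%:R.
  rewrite /excess /T0 cardsU1; have -> : i \notin [set (f x).1 | x in J].
    by apply/imsetP => -[x /(subsetP Js) /f_lt_i + ii]; rewrite -ii ltnn.
  rewrite card_in_imset => [|x y xJ yJ xy]; last first.
    by apply: f_inj; rewrite /= ?xy // (subsetP Jus) // setU1r.
  rewrite natrD; congr (_ + _ - _ * _%:R).
  rewrite /E0 card_in_imset // => e e'; rewrite !inE => /andP[_ eJ] /andP[_ eJ'].
  move=> /setP ee'; apply/setP => x.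
  have sub (a b : {set W}) : a \subset u |: J -> b \subset u |: J ->
      (forall v, (v \in f @: a) = (v \in f @: b)) -> x \in a -> x \in b.
    move=> aJ bJ ab xa; have := imset_f f xa; rewrite ab => /imsetP[y yb fxy].
    suff -> : x = y by [].
    apply: f_inj; rewrite ?fxy //.
      exact: (subsetP Jus _ (subsetP aJ _ xa)).
    exact: (subsetP Jus _ (subsetP bJ _ yb)).
  by apply/idP/idP; apply: sub => // v; rewrite ee'.
(* The items of J are added from oldest to youngest: the item of x then shares
   no edge at the round of x with what was built before. *)
have build t : suffix t s -> exists k T E,
  [/\ E \subset G, rounds E \subset T, T0 \subset T & forall t', t' \in T -> (t' <= i)%N] /\
  [/\ (forall e, e \in E -> e \in E0 \/
         exists2 x, x \in t & forall v, v \in e -> (v.1 <= (f x).1)%N),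
      excess T E <= excess T0 E0 + \sum_(x <- t | x \in J) (cost F r th t x - 1) - eps * k%:R,
      (#|E| <= #|F| + size t * size_bound (k * m.+1 + size t))%N &
      (k <= size t * K)%N].
  elim: t => [|x t IH] xts.
    exists 0%N, T0, E0; split; split=> //.
    - by move=> e eE; left.
    - by rewrite big_nil mulr0 subr0 addr0.
    - rewrite mul0n addn0; apply: leq_trans (leq_imset_card _ _) _.
      by apply/subset_leq_card/subsetP => e; rewrite inE => /andP[].
  have [xs ts] : x \in s /\ suffix t s.
    have /suffixP[t' sE] := xts; split; first by rewrite sE mem_cat mem_head orbT.
    by apply/suffixP; exists (rcons t' x); rewrite cat_rcons.
  have xt_s y : y \in x :: t -> y \in s.
    by have /suffixP[t' ->] := xts; rewrite mem_cat => ->; rewrite orbT.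
  have [xt ut] : x \notin t /\ uniq t.
    have /suffixP[t' sE] := xts; move: us; rewrite sE cat_uniq => /and3P[_ _].
    by case/andP.
  have pwx : pairwise (fun x y => (f y).1 < (f x).1)%N (x :: t).
    have /suffixP[t' sE] := xts; move: pws; rewrite sE pairwise_cat.
    by case/and3P.
  have costt : \sum_(y <- t | y \in J) (cost F r th (x :: t) y - 1) =
      \sum_(y <- t | y \in J) (cost F r th t y - 1).
    rewrite big_seq_cond [RHS]big_seq_cond; apply: eq_bigr => y /andP[yt _].
    by rewrite cost_cons; case: eqP => // yx; rewrite -yx yt in xt.
  have [k [T [E [[EG ET T0T Ti] [E0E exE cE cK]]]]] := IH ts.
  have mono k1 k2 l1 l2 : (k1 <= k2)%N -> (l1 <= l2)%N ->
      (size_bound (k1 * m.+1 + l1) <= size_bound (k2 * m.+1 + l2))%N.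
    by move=> h1 h2; apply: size_bound_mono; rewrite leq_add // leq_mul2r h1 orbT.
  have [xJ|xJ] := boolP (x \in J); last first.
    exists k, T, E; split; split=> //.
    - move=> e /E0E[|[y yt ye]]; [by left|right; exists y => //].
      by rewrite inE yt orbT.
    - by rewrite big_cons (negPf xJ) costt.
    - apply: leq_trans cE _; rewrite leq_add2l /= leq_mul //.
      by apply: mono.
    - by apply: leq_trans cK _; rewrite leq_mul2r leqnSn orbT.
  pose i' := (f x).1; pose j' := (f x).2.
  have fx : f x = (i', j') by rewrite /i' /j'; case: (f x).
  have colx : col (i', j') = c by rewrite -fx; exact/eqP/colf.
  have i'i : (i' < i)%N by exact: f_lt_i.
  have [k' [T' [E' [[E'G E'T i'T' T'i'] E'b ex' cE' k'K]]]] : item i' j' (x :: t).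
    apply: (items _ _ _ f) => //.
    apply/and5P; split; rewrite ?fx ?colx //.
    - by apply/allP => y yt; apply: colf; apply: xt_s; rewrite inE yt orbT.
    - by rewrite /= xt.
    apply/forall_inP => e eF; apply/implyP => exs.
    have /implyP := edges e eF; apply; apply: subset_trans exs _.
    by apply/subsetP => y /xt_s ys; rewrite inE ys orbT.
  have cE'C : (#|E'| <= C)%N.
    apply: leq_trans cE' _; apply: leq_trans hC; apply: mono => //.
    by apply: uniq_size; rewrite /= xt ut.
  (* A common edge at this round cannot come from an older item, so it joins x to an older vertex of
     the copy; it is then a back edge, which items exclude. *)
  have i'E : i' \notin rounds (E :&: E').
    apply/negP => /roundsP[e [v [+ ve vi']]]; rewrite inE => /andP[eE eE'].
    have e_le w : w \in e -> (w.1 <= i')%N.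
      move=> we; apply: T'i'; apply: (subsetP E'T).
      by apply/roundsP; exists e, w.
    have [/imsetP[e' + ee']|[y yt ye]] := E0E e eE; last first.
      have := ye v ve; rewrite vi' leqNgt.
      by have /andP[/allP/(_ y yt)] := pwx; rewrite -/i' => ->.
    rewrite inE => /andP[e'F e'J].
    have := subsetP hF e' e'F; rewrite inE => /cards2P[a [b [ab e'E]]].
    have e's y : y \in e' -> y \in u :: s.
      by move=> /(subsetP e'J) /(subsetP Jus).
    have wl a' b' : a' != b' -> e' = [set a'; b'] -> (f a').1 = i' -> False.
      move=> ab' e'E' fa'.
      have a'x : a' = x.
        apply: f_inj; rewrite ?inE ?xs ?orbT //; last by rewrite fa'.
        by rewrite -in_cons e's // e'E' set21.
      have b's : b' \in u :: s by rewrite e's // e'E' set22.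
      have fb' : ((f b').1 < i')%N.
        rewrite ltn_neqAle e_le ?andbT; last by rewrite ee' imset_f // e'E' set22.
        apply: contraNneq ab' => fb'; rewrite a'x; apply/eqP/f_inj => //.
        by rewrite inE xs orbT.
      have b's' : b' \in s.
        move: b's fb'; rewrite inE => /orP[/eqP ->|//].
        by rewrite fu ltnNge ltnW.
      have := E'b e v eE' ve vi'; apply/negP; rewrite negbK.
      apply/existsP; exists (f b'); rewrite fb' ee' e'E' imsetU1 imset_set1.
      by rewrite a'x -fx eqxx /= (eqP (colf x xs)); exact: colf.
    move: ve; rewrite ee' => /imsetP[y + vy]; rewrite e'E !inE.
    rewrite vy in vi'; case/orP => /eqP yE; rewrite yE in vi'.
      exact: (wl a b).
    by apply: (wl b a) => //; rewrite 1?eq_sym // finset.setUC.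
  have i'T0 : i' \in T0 by rewrite setU1r // (imset_f (fun x => (f x).1)).
  exists (k + k')%N, (T :|: T'), (E :|: E'); split; split.
  - by rewrite subUset EG.
  - exact: rounds_union.
  - exact: subset_trans (subsetUl _ _).
  - move=> t' /setUP[/Ti//|/T'i' h]; exact: leq_trans h (ltnW i'i).
  - move=> e /setUP[/E0E[|[y yt ye]]|eE'].
    + by left.
    + by right; exists y; rewrite // inE yt orbT.
    + right; exists x; rewrite ?mem_head // => v ve.
      apply: T'i'; apply: (subsetP E'T); by apply/roundsP; exists e, v.
  - have := excess_glue hG EG ET E'T cE'C (subsetP T0T _ i'T0) i'T' i'E.
    rewrite big_cons xJ costt cost_cons eqxx natrD mulrDr.
    move: exE ex'; lra.
  - apply: leq_trans (leq_card_setU _ _) _.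
    rewrite [size (x :: t)]/= mulSn addnCA [leqRHS]addnC.
    apply: leq_add.
      apply: leq_trans cE _; rewrite leq_add2l leq_mul2l; apply/orP; right.
      by apply: mono; rewrite ?leq_addr.
    by apply: leq_trans cE' _; apply: mono; rewrite ?leq_addl.
  - by rewrite mulSn addnC leq_add.
have [k [T [E [[EG ET T0T Ti] [E0E exE cE cK]]]]] := build s (suffix_refl s).
have sm : (size s <= m)%N := uniq_size us.
exists k, T, E; split.
- split=> //; apply: (subsetP T0T); exact: setU11.
- move=> e v eE ve vi; have [/imsetP[e' + ee']|[y ys ye]] := E0E e eE; last first.
    by have := ye v ve; rewrite vi leqNgt f_lt_i.
  rewrite inE => /andP[e'F e'J].
  have := subsetP hF e' e'F; rewrite inE => /cards2P[a [b [ab e'E]]].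
  have wl a' b' : a' != b' -> e' = [set a'; b'] -> (f a').1 = i -> back_edge i j c e.
    move=> ab' e'E' fa'.
    have a'u : a' = u.
      have : a' \in u |: J by apply: (subsetP e'J); rewrite e'E' set21.
      by case/setU1P => // /(subsetP Js) /f_lt_i; rewrite fa' ltnn.
    have b'J : b' \in J.
      have : b' \in u |: J by apply: (subsetP e'J); rewrite e'E' set22.
      by case/setU1P => // b'u; rewrite a'u b'u eqxx in ab'.
    have b's := subsetP Js _ b'J.
    apply/existsP; exists (f b'); rewrite f_lt_i // colf // ee' e'E'.
    by rewrite imsetU1 imset_set1 a'u fu eqxx.
  move: ve; rewrite ee' => /imsetP[y + vy]; rewrite e'E !inE -e'E -ee'.
  rewrite vy in vi; case/orP => /eqP yE; rewrite yE in vi.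
    exact: (wl a b).
  by apply: (wl b a) => //; rewrite 1?eq_sym // finset.setUC.
- rewrite dE; apply: le_trans exE _; rewrite ex0.
  have -> : \sum_(x <- s | x \in J) (cost F r th s x - 1) =
      \sum_(x in J) cost F r th s x - #|J|%:R.
    rewrite big_mkcond big_uniq // -big_mkcondr /=.
    rewrite -sumr_const -sumrB; apply: eq_bigl => x.
    by case: (boolP (x \in J)) => [/(subsetP Js) ->|]; rewrite ?andbF.
  lra.
- apply: leq_trans cE _; rewrite leq_add2l /= leq_mul2r; apply/orP; right.
  exact: sm.
- by apply: leq_trans cK _; rewrite leq_mul2r sm orbT.
Qed.

(** The first case is counted by k; in the second the list does not grow. Either way the index of
    [size_bound] is controlled. *)
Definition worse s' s : Prop :=
  danger F r th s' + eps <= danger F r th s \/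
  danger F r th s' <= danger F r th s /\ (size s' <= size s)%N.

Hypothesis greedy : forall i j s f, s != [::] ->
  completes i j (col (i, j)) s f -> exists B : {set 'I_r * 'I_r},
    [/\ (j, col (i, j)) \in B, (r <= #|B|)%N &
        forall b, b \in B -> exists s' f', completes i b.1 b.2 s' f' /\ worse s' s].
Hypotheses (r0 : (0 < r)%N) (eps0 : 0 < eps) (hK : 1 <= eps * K%:R).
Hypothesis hC' : (size_bound ((r ^ 2 * (m * K).+1) * m.+1 + m) <= C)%N.

(** The branches are glued at their common round i, where by [back_edge_inj] they share no edge;
    each adds its danger. *)
Lemma round_of_branches i s (bs : seq ('I_r * 'I_r)) :
  (forall i' j' s' f', (i' < i)%N -> completes i' j' (col (i', j')) s' f' ->
     s' != [::] -> item i' j' s') ->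
  s != [::] -> uniq bs ->
  (forall b, b \in bs -> exists s' f', completes i b.1 b.2 s' f' /\ worse s' s) ->
  exists k T E, [/\ structure i T E,
    (forall e v, e \in E -> v \in e -> v.1 = i ->
       exists2 b, b \in bs & back_edge i b.1 b.2 e),
    excess T E <= 1 + (size bs)%:R * danger F r th s - eps * k%:R,
    (#|E| <= size bs * branch_bound (k * m.+1 + (size s).-1))%N &
    (k <= size bs * (m * K).+1)%N].
Proof.
move=> items s0; elim: bs => [|b bs IH] /=.
  move=> _ _; exists 0%N, [set i], finset.set0; split.
  - exact: structure1.
  - by move=> e v; rewrite inE.
  - by rewrite /excess cards0 cards1 !mul0r !mulr0 !subr0 addr0.
  - by rewrite cards0.
  - by [].
move=> /andP[bbs ubs] wbs.
have [|k [T [E [st Eb ex cE cK]]]] := IH ubs.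
  by move=> b' b'bs; apply: wbs; rewrite inE b'bs orbT.
have [s' [f' [cs' ws']]] := wbs b (mem_head _ _).
have [k' [T' [E' [st' E'b ex' cE' k'K]]]] := branch_of_items items cs'.
have s'm : (size s' <= m)%N.
  by case: s' cs' {ws' ex' cE'} => // u s' /and5P[_ _ /uniq_size].
(* [z] records a strict drop; the m + 1 it adds to the index absorbs any size of s'. *)
pose z := nat_of_bool (danger F r th s' + eps <= danger F r th s).
have [dz idx] : danger F r th s' <= danger F r th s - eps * z%:R /\
    (k' * m.+1 + (size s').-1 <= (k' + z) * m.+1 + (size s).-1)%N.
  rewrite /z; case: (boolP (_ + eps <= _)) => [h|nh].
    split; first by rewrite mulr1n mulr1 lerBrDr.
    rewrite mulnDl mul1n -addnA leq_add2l; apply: leq_trans (leq_pred _) _.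
    by apply: leq_trans s'm _; exact: leq_trans (leqnSn m) (leq_addr _ _).
  case: ws' => [h|[h le_size]]; first by rewrite h in nh.
  split; first by rewrite mulr0n mulr0 subr0.
  by rewrite addn0 leq_add2l -!subn1 leq_sub2r.
have cE'C : (#|E'| <= C)%N.
  apply: leq_trans hC'; apply: leq_trans cE' _.
  apply: (@leq_trans (size_bound (m * K * m.+1 + m).+1)).
    apply: (@leq_trans (branch_bound (m * K * m.+1 + m))).
      apply: branch_bound_mono; rewrite leq_add ?leq_mul //.
      exact: leq_trans (leq_pred _) s'm.
    by rewrite [leqRHS]/= leq_pmull // expn_gt0 r0.
  apply: size_bound_mono; rewrite -addSn leq_add2r.
  apply: (@leq_trans ((m * K).+1 * m.+1)); first by rewrite mulSn -add1n leq_add2r.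
  by rewrite leq_mul2r leq_pmull ?orbT // expn_gt0 r0.
have iE : i \notin rounds (E :&: E').
  apply/negP => /roundsP[e [v [+ ve vi]]]; rewrite inE => /andP[eE eE'].
  have [b' b'bs bb'] := Eb e v eE ve vi.
  have := back_edge_inj bb' (E'b e v eE' ve vi).
  by rewrite -!surjective_pairing => b'b; rewrite -b'b b'bs in bbs.
have [EG ET iT Ti] := st; have [E'G E'T iT' T'i] := st'.
exists (k + (k' + z))%N, (T :|: T'), (E :|: E'); split.
- split; rewrite ?subUset ?EG ?rounds_union ?inE ?iT //.
  by move=> t /setUP[/Ti|/T'i].
- move=> e v /setUP[eE|eE'] ve vi.
    by have [b' b'bs bb'] := Eb e v eE ve vi; exists b' => //; rewrite inE b'bs orbT.
  by exists b; [exact: mem_head|exact: E'b ve vi].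
- have := excess_glue hG EG ET E'T cE'C iT iT' iE.
  rewrite !natrD -[in X in _ -> X]natr1; move: ex ex' dz; lra.
- apply: leq_trans (leq_card_setU _ _) _; rewrite mulSn addnC leq_add //.
    apply: leq_trans cE' _; apply: branch_bound_mono; apply: leq_trans idx _.
    by rewrite leq_add2r leq_mul2r leq_addl orbT.
  apply: leq_trans cE _; rewrite leq_mul2l branch_bound_mono ?orbT //.
  by rewrite leq_add2r leq_mul2r leq_addr orbT.
- rewrite mulSn addnC leq_add // -addn1 leq_add // /z.
  by case: (_ <= _).
Qed.

(** Strong induction on the round. Leaving out the chosen pair keeps at least r - 1 branches, and
    positivity of the excess then forces eps k < 1, hence k at most K. *)
Lemma item_of_greedy i j s f : completes i j (col (i, j)) s f -> s != [::] ->
  item i j s.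
Proof.
have [n lt_in] := ubnP (i : nat).
elim: n i j s f lt_in => // n IH i j s f; rewrite ltnS => le_in cs s0.
have items i' j' s' f' : (i' < i)%N -> completes i' j' (col (i', j')) s' f' ->
    s' != [::] -> item i' j' s'.
  by move=> i'i; apply: IH; exact: leq_trans i'i le_in.
have [B [jB rB worseB]] := greedy s0 cs.
pose bs := enum (B :\ (j, col (i, j))).
have szbs : size bs = #|B :\ (j, col (i, j))| by rewrite -cardE.
have sz_lo : (r.-1 <= size bs)%N.
  by rewrite -ltnS prednK // szbs; move: rB; rewrite (cardsD1 (j, col (i, j)) B) jB.
have sz_hi : (size bs <= r ^ 2)%N.
  by rewrite szbs (leq_trans (max_card _)) // card_prod card_ord.
have [b|k [T [E [st Eb ex cE cK]]]] := round_of_branches items s0 (enum_uniq _ : uniq bs).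
  by rewrite mem_enum inE => /andP[_ /worseB].
have [EG ET iT Ti] := st.
have cE' : (#|E| <= size_bound (k * m.+1 + size s))%N.
  apply: leq_trans cE _; have -> : (k * m.+1 + size s)%N = (k * m.+1 + (size s).-1).+1.
    by case: (s) s0 => //= u t _; rewrite addnS.
  by rewrite [leqRHS]/= leq_mul2r sz_hi orbT.
have us : uniq s by case: (s) cs s0 => // u t /and5P[].
have ex' : excess T E <= 1 + r.-1%:R * danger F r th s - eps * k%:R.
  apply: le_trans ex _; rewrite lerD2r lerD2l.
  by rewrite ler_wnM2r ?danger_le0 // ler_nat.
exists k, T, E; split => //.
  move=> e v eE ve vi; have [b] := Eb e v eE ve vi.
  rewrite mem_enum !inE => /andP[bj _] be; apply: contra bj => /back_edge_inj /(_ be) ->.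
  by rewrite -surjective_pairing.
(* The crude bound on k makes sparseness applicable, which in turn improves the bound to K. *)
have ECs : (#|E| <= C)%N.
  apply: leq_trans cE' _; apply: leq_trans hC'; apply: size_bound_mono.
  rewrite leq_add ?uniq_size // leq_mul2r; apply/orP; right.
  by apply: leq_trans cK _; rewrite leq_mul2r sz_hi orbT.
have := excess_gt0 hG EG ET ECs iT => ex0.
have : eps * k%:R < 1.
  have : r.-1%:R * danger F r th s <= 0 by rewrite mulr_ge0_le0 ?danger_le0.
  by move: ex' ex0; lra.
by move=> /lt_le_trans /(_ hK); rewrite ltr_pM2l // ltr_nat => /ltnW.
Qed.

(** Keeping the chosen pair as well gives at least r branches, and their union still has positive
    excess. *)
Lemma sparse_margin i j s f : completes i j (col (i, j)) s f -> s != [::] ->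
  0 < 1 + r%:R * danger F r th s.
Proof.
move=> cs s0.
have items i' j' s' f' : (i' < i)%N -> completes i' j' (col (i', j')) s' f' ->
    s' != [::] -> item i' j' s'.
  by move=> _; exact: item_of_greedy.
have [B [jB rB worseB]] := greedy s0 cs.
have sz_lo : (r <= size (enum B))%N by rewrite -cardE.
have sz_hi : (size (enum B) <= r ^ 2)%N.
  by rewrite -cardE (leq_trans (max_card _)) // card_prod card_ord.
have [b|k [T [E [st Eb ex cE cK]]]] := round_of_branches items s0 (enum_uniq (mem B)).
  by rewrite mem_enum => /worseB.
have us : uniq s by case: (s) cs s0 => // u t /and5P[].
have [EG ET iT Ti] := st.
have ECs : (#|E| <= C)%N.
  apply: leq_trans cE _; apply: leq_trans hC'.
  apply: (@leq_trans (size_bound (k * m.+1 + (size s).-1).+1)).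
    by rewrite [leqRHS]/= leq_mul2r sz_hi orbT.
  apply: size_bound_mono; rewrite -addnS prednK; last by case: (s) s0.
  rewrite leq_add ?uniq_size // leq_mul2r; apply/orP; right.
  by apply: leq_trans cK _; rewrite leq_mul2r sz_hi orbT.
have := excess_gt0 hG EG ET ECs iT => ex0.
have h1 : (size (enum B))%:R * danger F r th s <= r%:R * danger F r th s.
  by rewrite ler_wnM2r ?danger_le0 // ler_nat.
have h2 : 0 <= eps * k%:R by rewrite mulr_ge0 // ltW.
by move: ex ex0 h1 h2; lra.
Qed.

End WitnessStructures.

Lemma finite_gap (R : realDomainType) (T : finType) (g : T -> R) :
  exists2 eps : R, 0 < eps & forall x y, g x < g y -> g x + eps <= g y.
Proof.
exists (\big[Num.min/1]_(z : T * T | g z.1 < g z.2) (g z.2 - g z.1)).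
  by apply: lt_bigmin => // z; rewrite subr_gt0.
move=> x y xy; rewrite addrC -lerBrDr.
exact: (@bigmin_le_cond _ _ _ _ (x, y)).
Qed.

Lemma completes_ext (W : finType) (F : {set {set W}}) (r N : nat)
    (G H : graph N r) (col col' : vertex N r -> 'I_r) (i : 'I_N) j c s f :
  (forall v : vertex N r, (v.1 < i)%N -> col v = col' v) ->
  (forall e, (last_round e <= i)%N -> (e \in G) = (e \in H)) ->
  completes F G col i j c s f -> completes F H col' i j c s f.
Proof.
move=> colE GH; case: s => [|u s] //= /and5P[/eqP fu cs us pw edges].
have lt_i x : x \in s -> ((f x).1 < i)%N.
  by have /andP[/allP lt_u _] := pw; move=> /lt_u; rewrite fu.
apply/and5P; split=> //; first by rewrite fu.
  apply/allP => x xs; rewrite -colE ?lt_i //.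
  exact: (allP cs).
apply/forall_inP => e eF; apply/implyP => es.
rewrite -GH; first by have /implyP := forall_inP edges e eF; apply.
apply/bigmax_leqP => v /imsetP[x xe ->].
have := subsetP es x xe; rewrite inE => /orP[/eqP ->|/lt_i/ltnW //].
by rewrite fu.
Qed.

(** * The greedy Ramsey strategy *)

Section GreedyStrategy.
Variables (R : realType) (W : finType) (F : {set {set W}}) (r N : nat) (th eta : R).

(** For small [eta] this compares danger first and length second. *)
Definition key (s : seq W) : R := danger F r th s + eta * (size s)%:R.

(** Lists of length at most #|W| suffice, as completed lists are duplicate-free; 0 is the key of the
    empty list. *)
Definition threat (G : graph N r) (col : vertex N r -> 'I_r) (i : 'I_N) (j c : 'I_r) : R :=
  \big[Num.min/0]_(x : (#|W|.-bseq W) * {ffun W -> vertex N r} |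
     completes F G col i j c x.1 x.2) key x.1.

Definition greedy_strategy : strategy {perm 'I_r} N r := fun G h =>
  if insub (size h) is Some i then
    sval (cid (balanced_assignment
      (threat G (fun v : vertex N r => nth (1%g : {perm 'I_r}) h v.1 v.2) i)))
  else 1%g.

Lemma threat_le G col i j c s f : completes F G col i j c s f ->
  threat G col i j c <= key s.
Proof.
move=> cs; have sW : (size s <= #|W|)%N.
  case: s cs => // u s /and5P[_ _ us _ _].
  by rewrite -(card_uniqP us); exact: max_card.
exact: (@bigmin_le_cond _ R _ 0 ((Bseq sW : #|W|.-bseq W), f)
  (fun x => completes F G col i j c x.1 x.2) (fun x => key x.1) cs).
Qed.

Lemma threat_attained G col i j c : exists s f,
  completes F G col i j c s f /\ key s = threat G col i j c.
Proof.
rewrite /threat; apply: (big_ind (fun z => exists s f,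
  completes F G col i j c s f /\ key s = z)) => [|x y [s [f [cs <-]]] [s' [f' [cs' <-]]]|x cx].
- by exists [::], [ffun=> (i, j)]; rewrite /key /danger mulr0 addr0.
- by case: leP => _; [exists s, f|exists s', f'].
- by exists x.1, x.2.
Qed.

Lemma threat_ext (G H : graph N r) (col col' : vertex N r -> 'I_r) (i : 'I_N) j c :
  (forall v : vertex N r, (v.1 < i)%N -> col v = col' v) ->
  (forall e, (last_round e <= i)%N -> (e \in G) = (e \in H)) ->
  threat G col i j c = threat H col' i j c.
Proof.
move=> colE GH; apply: eq_bigl => x; apply/idP/idP; apply: completes_ext => // v.
  by move=> vi; rewrite colE.
by move=> vi; rewrite GH.
Qed.

Lemma greedy_strategyP G i j : exists B : {set 'I_r * 'I_r},
  let col := ramsey_color greedy_strategy G in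
  [/\ (j, col (i, j)) \in B, (r <= #|B|)%N &
      forall b, b \in B -> threat G col i b.1 b.2 <= threat G col i j (col (i, j))].
Proof.
set col := ramsey_color _ G.
have : col (i, j) = decision greedy_strategy G i j by [].
pose col' G' := fun v : vertex N r =>
  nth (1%g : {perm 'I_r}) (history greedy_strategy G' i) v.1 v.2.
have threatE b : threat (revealed G i.+1) (col' G) i b.1 b.2 =
    threat G col i b.1 b.2.
  apply: threat_ext => [v vi|e le_e]; last by rewrite mem_revealed le_e andbT.
  by rewrite /col' nth_history.
rewrite /decision {1}/greedy_strategy size_history.
case: insubP => [i' _ /val_inj ->|]; last by rewrite ltn_ord.
case: cid => sigma /= /(_ j) [B [jB rB Bj]] colE.
exists B; split; rewrite ?colE // => b bB.
by rewrite -(threatE (j, sigma j)) -threatE; exact: Bj.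
Qed.

End GreedyStrategy.

Lemma ramsey_color_inj (N r : nat) (st : strategy {perm 'I_r} N r) (G : graph N r)
    (v w : vertex N r) :
  v.1 = w.1 -> ramsey_color st G v = ramsey_color st G w -> v = w.
Proof.
case: v w => [i j] [i' j'] /= <-; rewrite /ramsey_color /=.
by move=> /perm_inj ->.
Qed.

(** Vertices of one color lie in distinct rounds, so a monochromatic copy orders F by age; some
    suffix then has 1 + r danger at most 0, against [sparse_margin]. *)
Lemma greedy_wins (R : realType) (W : finType) (F : {set {set W}}) (r : nat) (th : R) :
  is_graph F -> (0 < r)%N ->
  (forall s, perm_eq s (enum W) -> margin F r th s <= 0) ->
  exists (eta : R) (C : nat), forall N (G : graph N r), sparse G th C ->
    ramsey_wins F (greedy_strategy F th eta) G.
Proof.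
move=> hF r0 hm; set m := #|W|.
have [eps eps0 gap] := finite_gap (fun s : m.-bseq W => danger F r th s).
pose eta := eps / m.+1%:R.
have [K hK] : exists K : nat, 1 <= eps * K%:R.
  exists (Num.truncn eps^-1).+1.
  by rewrite mulrC -ler_pdivrMr // div1r ltW // truncnS_gt.
pose C := maxn (size_bound F r m (K * m.+1 + m))
               (size_bound F r m ((r ^ 2 * (m * K).+1) * m.+1 + m)).
exists eta, C => N G hG; set st := greedy_strategy F th eta.
pose col := ramsey_color st G.
have eta0 : 0 < eta by rewrite divr_gt0 ?ltr0Sn.
have greedy (i : 'I_N) j s f : s != [::] ->
  completes F G col i j (col (i, j)) s f -> exists B : {set 'I_r * 'I_r},
    [/\ (j, col (i, j)) \in B, (r <= #|B|)%N &
        forall b, b \in B -> exists s' f', completes F G col i b.1 b.2 s' f' /\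
          worse F r th eps s' s].
  move=> _ cs; have [B [jB rB Bj]] := greedy_strategyP F th eta G i j.
  exists B; split=> // b bB; have := Bj b bB.
  have [s' [f' [cs' <-]]] := threat_attained F th eta G col i b.1 b.2.
  move=> /le_trans /(_ (threat_le th eta cs)) le_key.
  exists s', f'; split=> //.
  have bs (j' c' : 'I_r) t g : completes F G col i j' c' t g -> (size t <= m)%N.
    case: t => // u t /and5P[_ _ ut _ _].
    by rewrite -(card_uniqP ut); exact: max_card.
  have sm := bs _ _ _ _ cs; have s'm := bs _ _ _ _ cs'.
  have gp := gap (Bseq sm) (Bseq s'm); have gp' := gap (Bseq s'm) (Bseq sm).
  rewrite /= in gp gp'.
  move: le_key; rewrite /key => le_key.
  have [lt|ge] := ltP (danger F r th s') (danger F r th s).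
    by left; exact: gp'.
  have [lt|le] := ltP (danger F r th s) (danger F r th s'); last first.
    right; split=> //.
    have : eta * (size s')%:R <= eta * (size s)%:R.
      by rewrite -(lerD2l (danger F r th s)) (le_trans _ le_key) // lerD2r.
    by rewrite ler_pM2l // ler_nat.
  (* A larger danger of s' would be larger by at least eps, more than the length term of s can
     offset. *)
  exfalso; have := gp lt.
  have : eta * (size s)%:R < eps.
    rewrite /eta mulrAC ltr_pdivrMr ?ltr0Sn // ltr_pM2l // ltr_nat.
    by rewrite ltnS.
  have : 0 <= eta * (size s')%:R by rewrite mulr_ge0 // ltW.
  by move: le_key; lra.
apply/forallP => c; apply/negP => /existsP[f /and3P[/injectiveP f_inj fS fF]].
have fc x : col (f x) = c by have := forallP fS x; rewrite inE => /eqP.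
have round_inj x y : (f x).1 = (f y).1 -> x = y.
  by move=> xy; apply/f_inj/(ramsey_color_inj (st := st) (G := G) xy); rewrite -/col !fc.
pose s := sort (fun x y => (f y).1 <= (f x).1)%N (enum W).
have sW : perm_eq s (enum W) by rewrite perm_sort.
have pws : pairwise (fun x y => (f y).1 < (f x).1)%N s.
  have : pairwise (fun x y => (f y).1 <= (f x).1)%N s.
    rewrite -sorted_pairwise; last by move=> y x z h1 h2; exact: leq_trans h2 h1.
    by apply: sort_sorted => x y; exact: leq_total.
  have : uniq s by rewrite (perm_uniq sW) enum_uniq.
  elim: (s) => //= x t IH /andP[xt ut] /andP[/allP le_x /(IH ut) ->].
  rewrite andbT; apply/allP => y yt; rewrite ltn_neqAle le_x // andbT.
  by apply: contraNneq xt => /ord_inj /round_inj <-.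
have [t [u [s' [sE mle]]]] := margin_le0 (hm s sW).
have us : uniq s by rewrite (perm_uniq sW) enum_uniq.
have cs : completes F G col (f u).1 (f u).2 (col ((f u).1, (f u).2)) (u :: s') f.
  move: us pws; rewrite sE cat_uniq pairwise_cat => /and3P[_ _ uus].
  move=> /and3P[_ _ pwu]; apply/and5P; split=> //.
  - by rewrite -surjective_pairing.
  - by apply/allP => x _; rewrite -surjective_pairing !fc.
  - by apply/forall_inP => e eF; apply/implyP => _; exact: (forall_inP fF).
suff : 0 < 1 + r%:R * danger F r th (u :: s') by rewrite ltNge mle.
exact: (sparse_margin hF (leqnn m) hG (leq_maxl _ _) greedy r0 eps0 hK
  (leq_maxr _ _) cs).
Qed.

(** * First moment bound for sparseness *)

Lemma bin_le_exp n k : ('C(n, k) <= n ^ k)%N.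
Proof.
apply: (@leq_trans (n ^_ k)); first by rewrite -bin_ffact leq_pmulr // fact_gt0.
by elim: k => // k IH; rewrite ffactnSr expnSr leq_mul ?leq_subr.
Qed.

(** Union bound over the violating edge sets, grouped by their number k of rounds: there are at most
    N ^ k times a constant of them, each present with probability at most delta / L ^ k. *)
Lemma sparse_prob (R : realType) (N r C Q : nat) (p th L delta : R) :
  0 <= p <= 1 -> 0 < L -> N%:R <= L -> 0 <= delta -> th * C%:R < Q%:R ->
  0 <= th ->
  (forall q v : nat, (0 < q)%N -> v%:R <= th * q%:R -> p ^+ q * L ^+ v <= delta) ->
  gnp_prob p (fun G : graph N r => ~~ `[< sparse G th C >]) <=
    (Q * 2 ^ 2 ^ (Q * r))%:R * delta.
Proof.
move=> p01 L0 NL d0 hQ th0 hp.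
pose P (E : graph N r) := [&& E \subset pairs (vertex N r), E != finset.set0,
  (#|E| <= C)%N & #|rounds E|%:R <= th * #|E|%:R].
apply: (@le_trans _ _ (\sum_(E | P E) gnp_prob p (fun G => E \subset G))).
  apply: gnp_prob_union => // G gG /negP; rewrite asboolE.
  move=> nsp; have [E hE] : exists E : graph N r, [/\ E \subset G, E != finset.set0,
      (#|E| <= C)%N & #|rounds E|%:R <= th * #|E|%:R].
    apply: contra_notP nsp => nE E EG E0 EC; rewrite ltNge; apply/negP => h.
    by apply: nE; exists E.
  case: hE => EG E0 EC hE; exists E => //.
  by rewrite /P E0 EC hE !andbT; exact: subset_trans EG gG.
have roundsQ E : P E -> (#|rounds E| < Q)%N.
  case/and4P => _ _ EC hE; rewrite -(ltr_nat R); apply: le_lt_trans hE _.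
  apply: le_lt_trans hQ; rewrite ler_wpM2l // ler_nat //.
apply: (@le_trans _ _ (\sum_(E | P E) delta / L ^+ #|rounds E|)).
  apply: ler_sum => E /and4P[EP E0 EC hE]; rewrite gnp_prob_sub //.
  by rewrite ler_pdivlMr ?exprn_gt0 // hp // card_gt0.
rewrite (partition_big (fun E : graph N r => inord #|rounds E| : 'I_Q.-1.+1) xpredT) //=.
have [Q0|Q0] := posnP Q.
  rewrite Q0 mul0n mul0r big1 // => k _; rewrite big_pred0 // => E.
  by apply/negP => /andP[/roundsQ]; rewrite Q0.
rewrite -[X in (X * _)%N](prednK Q0) natrM -mulrA mulr_natl -[X in _ *+ X]card_ord -sumr_const.
apply: ler_sum => k _.
have -> : \sum_(E | P E && (inord #|rounds E| == k)) delta / L ^+ #|rounds E| =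
    \sum_(E | P E && (inord #|rounds E| == k)) delta / L ^+ k.
  apply: eq_bigr => E /andP[/roundsQ EQ /eqP <-].
  by rewrite inordK // prednK.
rewrite sumr_const.
have kQ : (k < Q)%N by rewrite -[X in (_ < X)%N](prednK Q0).
suff card_le : (#|[pred E | P E && (inord #|rounds E| == k)]| <= N ^ k * 2 ^ 2 ^ (Q * r))%N.
  rewrite -[leLHS]mulr_natl; apply: (@le_trans _ _ ((N ^ k * 2 ^ 2 ^ (Q * r))%:R * (delta / L ^+ k))).
    by rewrite ler_wpM2r ?ler_nat // divr_ge0 // exprn_ge0 // ltW.
  rewrite natrM natrX mulrAC [leRHS]mulrC ler_wpM2r //.
  rewrite mulrCA ler_piMr // ler_pdivrMr ?exprn_gt0 // mul1r.
  by rewrite lerXn2r ?nnegrE ?ler0n ?(ltW L0).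
pose S (T : {set 'I_N}) : {set graph N r} :=
  powerset (powerset (setX T [set: 'I_r])).
apply: (@leq_trans (\sum_(T : {set 'I_N} | #|T| == k) #|S T|)%N).
  rewrite -sum1_card (partition_big (@rounds r N) (fun T => #|T| == k)) /=; last first.
    move=> E /andP[/roundsQ EQ /eqP <-].
    by rewrite inordK // prednK.
  apply: leq_sum => T _; rewrite sum1dep_card; apply/subset_leq_card/subsetP => E.
  rewrite inE => /andP[_ /eqP <-]; rewrite powersetE; apply/subsetP => e eE.
  rewrite powersetE; apply/subsetP => v ve; rewrite !inE andbT.
  by apply/exists_inP; exists e => //; apply/exists_inP; exists v.
rewrite (eq_bigr (fun=> 2 ^ 2 ^ (k * r)))%N; last first.
  by move=> T /eqP Tk; rewrite !card_powerset cardsX cardsT card_ord Tk.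
rewrite sum_nat_const; apply: leq_mul.
  have := card_draws 'I_N k; rewrite card_ord cardsE => ->; exact: bin_le_exp.
by rewrite leq_exp2l // leq_exp2l // leq_mul2r ltnW ?orbT.
Qed.

Lemma much_smallerP (R : realType) (r : nat) (f g : nat -> R) :
  much_smaller r f g <-> forall eps : R, 0 < eps ->
    exists n0, forall N, (n0 <= N)%N -> `|f (N * r)%N| <= eps * `|g (N * r)%N|.
Proof.
rewrite /much_smaller; split=> [/eqoP fg eps eps0|fg].
  by have [n0 _ h] := fg eps eps0; exists n0.
apply/eqoP => eps eps0; have [n0 h] := fg eps eps0.
by exists n0.
Qed.

Lemma cvg_to1P (R : realType) (u : nat -> R) : (forall N, u N <= 1) ->
  (u N @[N --> \oo] --> (1 : R))%classic <-> forall eps : R, 0 < eps ->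
    exists n0, forall N, (n0 <= N)%N -> 1 - eps <= u N.
Proof.
move=> u1; split=> [/cvgrPdist_le uc eps eps0|uc].
  have [n0 _ h] := uc eps eps0; exists n0 => N /h /=.
  by rewrite ger0_norm ?subr_ge0 // lerBlDr addrC -lerBlDr.
apply/cvgrPdist_le => eps eps0; have [n0 h] := uc eps eps0.
exists n0 => // N /= /h; rewrite ger0_norm ?subr_ge0 //.
by rewrite lerBlDr [leRHS]addrC -lerBlDr.
Qed.

(** * Both games at the threshold n ^ (- th) *)

Section Threshold.
Variables (R : realType) (W : finType) (F : {set {set W}}) (r : nat).
Hypotheses (hF : is_graph F) (r0 : (0 < r)%N).
Variables (th : R).
Hypotheses (th0 : 0 < th).

(** The shift to n + 1 keeps the value positive at n = 0. *)
Definition power_threshold (n : nat) : R := n.+1%:R `^ (- th).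

Lemma power_threshold_gt0 n : 0 < power_threshold n.
Proof. by rewrite powR_gt0 // ltr0Sn. Qed.

Lemma power_thresholdX n q : power_threshold n ^+ q = n.+1%:R `^ (- (th * q%:R)).
Proof. by rewrite -powR_mulrn ?powR_ge0 // -powRrM mulNr. Qed.

Lemma expr_le_threshold n q v : v%:R <= th * q%:R ->
  n.+1%:R ^+ v * power_threshold n ^+ q <= 1.
Proof.
move=> vq; rewrite power_thresholdX -powR_mulrn ?ler0n // -powRD; last first.
  by rewrite pnatr_eq0 implybT.
by rewrite -[leRHS](powRr0 n.+1%:R) ler_powR ?ler1n // subr_le0.
Qed.

Lemma expr_ge_threshold n q v : th * q%:R <= v%:R ->
  1 <= n.+1%:R ^+ v * power_threshold n ^+ q.
Proof.
move=> vq; rewrite power_thresholdX -powR_mulrn ?ler0n // -powRD; last first.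
  by rewrite pnatr_eq0 implybT.
by rewrite -[leLHS](powRr0 n.+1%:R) ler_powR ?ler1n // subr_ge0.
Qed.

Lemma ramsey_wins_below (p : nat -> R) :
  (forall s, perm_eq s (enum W) -> margin F r th s <= 0) ->
  (forall n, 0 <= p n <= 1) -> much_smaller r p power_threshold ->
  exists st : forall N, strategy {perm 'I_r} N r,
    (gnp_prob (p (N * r)%N) (@ramsey_wins W F r N (st N)) @[N --> \oo] --> (1 : R))%classic.
Proof.
move=> hm p01 /much_smallerP pp0.
have [eta [C win]] := greedy_wins hF r0 hm.
exists (fun N => greedy_strategy F th eta); apply/cvg_to1P.
  by move=> N; exact: gnp_prob_le1.
move=> eps eps0.
(* Exceeds the number of rounds of any violating set of at most C edges. *)
pose Q := (Num.truncn (th * C%:R)).+1.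
pose c : R := (Q * 2 ^ 2 ^ (Q * r))%:R.
have c0 : 0 < c by rewrite ltr0n muln_gt0 expn_gt0.
pose eps' := Num.min 1 (eps / c).
have eps'0 : 0 < eps' by rewrite lt_min ltr01 divr_gt0.
have [n0 hn0] := pp0 eps' eps'0; exists n0 => N /hn0.
set n := (N * r)%N; have /andP[pn0 pn1] := p01 n.
have t0 := power_threshold_gt0 n.
rewrite ger0_norm // gtr0_norm // => pn.
have : gnp_prob (p n) (fun G : graph N r => ~~ `[< sparse G th C >]) <= c * eps'.
  apply: (@sparse_prob R N r C Q (p n) th n.+1%:R) => //.
  - by rewrite ler_nat leqW // leq_pmulr.
  - exact: ltW.
  - by rewrite truncnS_gt.
  - exact: ltW.
  move=> q v q0 vq; apply: (@le_trans _ _ (eps' ^+ q)).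
    apply: (@le_trans _ _ ((eps' * power_threshold n) ^+ q * n.+1%:R ^+ v)).
      by rewrite ler_wpM2r ?exprn_ge0 // lerXn2r ?nnegrE // mulr_ge0 // ltW.
    rewrite exprMn -mulrA ler_piMr ?(exprn_ge0 _ (ltW eps'0)) // mulrC.
    exact: expr_le_threshold.
  by rewrite -[leRHS]expr1 ler_wiXn2l ?(ltW eps'0) // ge_min lexx.
have ceps : c * eps' <= eps.
  by rewrite mulrC -ler_pdivlMr // ge_min lexx orbT.
move=> le1.
have : gnp_prob (p n) (fun G : graph N r => `[< sparse G th C >]) <=
    gnp_prob (p n) (@ramsey_wins W F r N (greedy_strategy F th eta)).
  by apply: (gnp_prob_mono (p01 n)) => G _ /asboolP; exact: win.
move: le1; rewrite gnp_probC; lra.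
Qed.

Lemma achlioptas_loses_above (s : seq W) (p : nat -> R) :
  perm_eq s (enum W) -> s != [::] -> 0 <= margin F r th s ->
  (forall n, 0 <= p n <= 1) -> much_smaller r power_threshold p ->
  forall st : forall N, strategy 'I_r N r,
    (gnp_prob (p (N * r)%N) (fun G => ~~ @achlioptas_wins W F r N (st N) G)
      @[N --> \oo] --> (1 : R))%classic.
Proof.
move=> sW sn0 hs p01 /much_smallerP pp0 st.
have us : uniq s by rewrite (perm_uniq sW) enum_uniq.
apply/cvg_to1P => [N|eps eps0]; first exact: gnp_prob_le1.
set z := tree_size r s.
have z0 : (0 < z)%N by rewrite /z; case: (s) sn0.
(* From n + 1 <= 2 N r and N < 2 M z. *)
pose kappa : R := (4 * z * r)%:R.
pose c : R := (2 * kappa) ^+ #|tree r s|.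
have k1 : 1 <= kappa by rewrite ler1n !muln_gt0 z0.
have c0 : 0 < c by rewrite exprn_gt0 // mulr_gt0 // (lt_le_trans ltr01).
pose eps' := Num.min 1 (eps / c).
have eps'0 : 0 < eps' by rewrite lt_min ltr01 divr_gt0.
have [n0 hn0] := pp0 eps' eps'0.
pose n1 := (Num.truncn eps'^-1).+1.
exists (maxn (maxn n0 n1) z) => N; rewrite !geq_max => /andP[/andP[/hn0 + n1N] zN].
set n := (N * r)%N; have /andP[pn0 pn1] := p01 n.
have t0 := power_threshold_gt0 n.
rewrite gtr0_norm // ger0_norm // => pn.
have p0 : 0 < p n.
  rewrite lt_neqAle pn0 andbT; apply/eqP => p0.
  by move: pn; rewrite -p0 mulr0 leNgt t0.
have eps'1 : eps' <= 1 by rewrite ge_min lexx.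
have tp : power_threshold n / p n <= eps' by rewrite ler_pdivrMr.
have tp0 : 0 <= power_threshold n / p n by rewrite divr_ge0 // ltW.
have Le : n.+1%:R^-1 <= eps'.
  rewrite -[leRHS]invrK lef_pV2 ?posrE ?invr_gt0 ?ltr0Sn //.
  apply: ltW; apply: lt_le_trans (truncnS_gt _) _; rewrite ler_nat.
  by apply: leq_trans n1N _; rewrite leqW // leq_pmulr.
pose M := (N %/ z)%N.
have M0 : (0 < M)%N by rewrite divn_gt0.
have zM : (z * M <= N)%N by rewrite mulnC leq_trunc_div.
have LM : n.+1%:R <= kappa * M%:R.
  rewrite -natrM ler_nat.
  have Nlt : (N < M.+1 * z)%N by rewrite ltn_ceil.
  have h1 : (N < 2 * M * z)%N.
    by apply: leq_trans Nlt _; rewrite leq_mul2r mul2n -addnn -addn1 leq_add2l M0 orbT.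
  have N0 : (0 < N)%N by exact: leq_trans z0 zN.
  apply: (@leq_trans (2 * (N * r))).
    by rewrite mul2n -addnn -addn1 leq_add2l muln_gt0 N0.
  have -> : (4 * z * r * M = 2 * (2 * M * z * r))%N by ring.
  by rewrite leq_mul2l leq_mul2r ltnW ?orbT.
have : gnp_prob (p n) (achlioptas_wins F (st N)) <= c * eps'.
  apply: (@achlioptas_win_prob R W F r N s M hF us zM (st N) (p n) th n.+1%:R) => //.
  - exact: ltW.
  (* Without common edges the gain comes from 1 / (n + 1) <= eps', otherwise from one factor
     threshold / p. *)
  move=> q v v0 qv; case: q qv => [|q] qv.
    rewrite expr0 invr1 -[leLHS](divff (lt0r_neq0 (ltr0Sn R n))).
    by rewrite ler_pM ?invr_ge0 // ler_eXnr ?ler1n.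
  have Lv0 : 0 <= n.+1%:R ^+ v :> R by rewrite exprn_ge0.
  apply: (@le_trans _ _ (n.+1%:R ^+ v * (power_threshold n / p n) ^+ q.+1)).
    rewrite expr_div_n mulrA -[leLHS]mul1r ler_wpM2r ?invr_ge0 ?exprn_ge0 //.
    exact: expr_ge_threshold.
  rewrite ler_wpM2l // exprS -[leRHS]mulr1 ler_pM ?exprn_ge0 // exprn_ile1 //.
  exact: le_trans tp eps'1.
rewrite gnp_probC => le1; have ceps : c * eps' <= eps.
  by rewrite mulrC -ler_pdivlMr // ge_min lexx orbT.
lra.
Qed.

End Threshold.

(** * Comparing thresholds *)

Section Conversion.
Variables (N r : nat) (c : 'I_r).

(** The Ramsey game is replayed on the revealed graph, so only the length of [h] matters. *)
Definition select_color (st : strategy {perm 'I_r} N r) : strategy 'I_r N r :=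
  fun G h => ((decision st G (size h))^-1)%g c.

Lemma select_color_selected st (G : graph N r) :
  achlioptas_selected (select_color st) G = [set v | ramsey_color st G v == c].
Proof.
apply/setP => -[i j]; rewrite !inE /= /ramsey_color /=.
have -> : decision (select_color st) G i = ((decision st G i)^-1)%g c.
  rewrite {1}/decision {1}/select_color size_history.
  suff -> : decision st (revealed G i.+1) i = decision st G i by [].
  by apply: decision_ext; rewrite revealed_revealed.
apply/eqP/eqP => [->|<-]; first exact: permKV.
by rewrite permK.
Qed.

Lemma select_color_wins (W : finType) (F : {set {set W}}) st (G : graph N r) :
  ramsey_wins F st G -> achlioptas_wins F (select_color st) G.
Proof. by move=> /forallP/(_ c); rewrite /achlioptas_wins select_color_selected. Qed.

End Conversion.

(* If p1 / p2 were unbounded, then along a sequence of rounds the geometric mean of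
   p1 and p2 would be far below p1 and far above p2. *)
Lemma threshold_le (R : realType) (D : Type) (r : nat)
    (wins : forall N, strategy D N r -> graph N r -> bool) (p1 p2 : nat -> R) :
  (0 < r)%N -> is_threshold wins p1 -> is_threshold wins p2 ->
  (forall eps : R, 0 < eps -> exists n0, forall N, (n0 <= N)%N -> p2 (N * r)%N <= eps) ->
  exists2 C : R, 0 < C &
    exists n0, forall N, (n0 <= N)%N -> p1 (N * r)%N <= C * p2 (N * r)%N.
Proof.
move=> r0 [p1_gt0 p1win _] [p2_gt0 _ p2lose] p2_to0.
apply: contrapT => unbounded.
have [phi phiP] : {phi : nat -> nat & forall k, (k <= phi k)%N /\
    k.+1%:R * p2 (phi k * r)%N < p1 (phi k * r)%N}.
  apply: (@choice _ _ (fun k N => (k <= N)%N /\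
    k.+1%:R * p2 (N * r)%N < p1 (N * r)%N)) => k.
  apply: contrapT => nk; apply: unbounded; exists k.+1%:R; first exact: ltr0Sn.
  exists k => N kN; rewrite leNgt; apply/negP => h.
  by apply: nk; exists N.
pose S N := `[< exists k, N = phi k >].
(* Both [p] and [p'] equal the capped geometric mean on the subsequence. Elsewhere [p] is 0, and
   [p'] is the capped root of p2, far above p2 since p2 tends to 0. *)
pose f n : R := Num.min 1 (Num.sqrt (p1 n * p2 n)).
have f01 n : 0 <= f n <= 1 by rewrite le_min ler01 sqrtr_ge0 ge_min lexx.
pose p n : R := if S (n %/ r)%N then f n else 0.
pose p' n : R := if S (n %/ r)%N then f n else Num.min 1 (Num.sqrt (p2 n)).
have p01 n : 0 <= p n <= 1 by rewrite /p; case: (S _); rewrite ?f01 // lexx ler01.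
have p'01 n : 0 <= p' n <= 1.
  rewrite /p'; case: (S _); first exact: f01.
  by rewrite le_min ler01 sqrtr_ge0 ge_min lexx.
have large_ratio (eps : R) : 0 < eps -> exists n0, forall N, (n0 <= N)%N -> S N ->
    p2 (N * r)%N <= eps ^+ 2 * p1 (N * r)%N.
  move=> eps0; pose K := Num.truncn ((eps ^+ 2)^-1).
  exists (\max_(k < K) phi k).+1 => N ltN /asboolP[k NE].
  have [_ h] := phiP k; rewrite -NE in h.
  have Kk : (K <= k)%N.
    rewrite leqNgt; apply/negP => kK; move: ltN; rewrite NE ltnNge.
    by rewrite (leq_bigmax (Ordinal kK)).
  rewrite -ler_pdivrMl ?exprn_gt0 //; apply: le_trans (ltW h).
  rewrite ler_wpM2r ?ltW // ; apply: lt_le_trans (truncnS_gt _) _.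
  by rewrite ler_nat.
have p_small : much_smaller r p p1.
  apply/much_smallerP => eps eps0; have [n0 h] := large_ratio eps eps0.
  exists n0 => N /h; rewrite /p mulnK //; case: (S N) => [/(_ isT) hN|_]; last first.
    by rewrite normr0 mulr_ge0 // ltW.
  have /andP[fN0 _] := f01 (N * r)%N.
  rewrite ger0_norm // gtr0_norm // ge_min; apply/orP; right.
  have -> : eps * p1 (N * r)%N = Num.sqrt ((eps * p1 (N * r)%N) ^+ 2).
    by rewrite sqrtr_sqr ger0_norm // mulr_ge0 // ltW.
  rewrite ler_wsqrtr //.
  by rewrite exprMn (expr2 (p1 _)) mulrCA ler_pM2l // hN.
have p'_large : much_smaller r p2 p'.
  apply/much_smallerP => eps eps0; have [n0 h] := large_ratio eps eps0.
  have e0 : 0 < Num.min eps (eps ^+ 2) by rewrite lt_min eps0 exprn_gt0.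
  have [n1 h1] := p2_to0 _ e0.
  exists (maxn n0 n1) => N; rewrite geq_max => /andP[/h {}h /h1].
  rewrite le_min => /andP[le1 le2].
  have b0 := p2_gt0 (N * r)%N; have a0 := p1_gt0 (N * r)%N.
  have sqrt_le x : 0 <= x -> p2 (N * r)%N <= eps ^+ 2 * x ->
      p2 (N * r)%N <= eps * Num.min 1 (Num.sqrt (x * p2 (N * r)%N)).
    move=> x0 bx; rewrite minr_pMr ?(ltW eps0) // le_min mulr1 le1 /=.
    have sqrtE (y : R) : 0 < y -> y = Num.sqrt (y ^+ 2).
      by move=> y0; rewrite sqrtr_sqr gtr0_norm.
    rewrite {1}(sqrtE _ b0) {1}(sqrtE _ eps0) -sqrtrM ?sqr_ge0 // ler_wsqrtr //.
    by rewrite [leLHS]expr2 mulrA ler_pM2r.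
  rewrite gtr0_norm // ger0_norm; last by have /andP[] := p'01 (N * r)%N.
  rewrite /p' mulnK //; case: (S N) h => [/(_ isT) hN|_].
    by apply: sqrt_le; rewrite // ltW.
  by have := sqrt_le 1 ler01; rewrite mul1r mulr1; apply.
(* At a late index of the subsequence [p] and [p'] agree, yet [st] would both win and lose with
   probability at least 3/4. *)
have [st /cvg_to1P st_win] := p1win p p01 p_small.
have /cvg_to1P st_lose := p2lose p' p'01 p'_large st.
have q0 : 0 < 4^-1 :> R by rewrite invr_gt0.
have [|n1 h1] := st_win _ _ q0; first by move=> N; exact: gnp_prob_le1.
have [|n2 h2] := st_lose _ _ q0; first by move=> N; exact: gnp_prob_le1.
have [] := phiP (maxn n1 n2); set N := phi _; rewrite geq_max => /andP[/h1 + /h2 +] _.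
have SN : S N by apply/asboolP; exists (maxn n1 n2).
rewrite gnp_probC /p /p' mulnK // SN; lra.
Qed.

Lemma same_orderP (R : realType) (r : nat) (f g : nat -> R) :
  (forall n, 0 < f n) -> (forall n, 0 < g n) ->
  (exists2 C : R, 0 < C &
    exists n0, forall N, (n0 <= N)%N -> f (N * r)%N <= C * g (N * r)%N) ->
  (exists2 C : R, 0 < C &
    exists n0, forall N, (n0 <= N)%N -> g (N * r)%N <= C * f (N * r)%N) ->
  same_order r f g.
Proof.
move=> f0 g0 [C C0 [n0 h0]] [C' C'0 [n1 h1]].
rewrite /same_order eqThetaE bigThetaE eqOmegaO; split; apply/eqO_exP.
  exists C => //; exists n0 => // N /= /h0.
  by rewrite !gtr0_norm.
exists C' => //; exists n1 => // N /= /h1.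
by rewrite !gtr0_norm.
Qed.

Lemma power_threshold_to0 (R : realType) (r : nat) (th : R) : (0 < r)%N -> 0 < th ->
  forall eps : R, 0 < eps -> exists n0, forall N, (n0 <= N)%N ->
    power_threshold th (N * r)%N <= eps.
Proof.
move=> r0 th0 eps eps0; exists (Num.truncn (eps^-1 `^ th^-1)).+1 => N leN.
rewrite /power_threshold powRN -[leRHS]invrK lef_pV2 ?posrE ?invr_gt0 //; last first.
  by rewrite powR_gt0 // ltr0Sn.
have eV0 : 0 <= eps^-1 by rewrite invr_ge0 ltW.
have -> : eps^-1 = (eps^-1 `^ th^-1) `^ th.
  by rewrite -powRrM mulVf ?lt0r_neq0 // powRr1.
apply: ge0_ler_powR; rewrite ?nnegrE ?powR_ge0 ?ler0n ?(ltW th0) //.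
apply: ltW; apply: lt_le_trans (truncnS_gt _) _; rewrite ler_nat; apply: leq_trans leN _.
by rewrite leqW // leq_pmulr.
Qed.

Theorem theorem2 (R : realType) (W : finType) (F : {set {set W}}) (r : nat)
    (hF : is_graph F) (hF0 : F != finset.set0) (hr : (2 <= r)%N) :
  (exists p0 : nat -> R,
     ramsey_threshold F r p0 /\ achlioptas_threshold F r p0) /\
  (forall p1 p2 : nat -> R,
     ramsey_threshold F r p1 -> achlioptas_threshold F r p2 ->
     same_order r p1 p2).
Proof.
have r0 : (0 < r)%N by exact: ltnW.
have [th [th0 [s sW hs] hm]] := critical_exponent R hF hF0 hr.
have sn0 : s != [::].
  have /set0Pn[e eF] := hF0; have := subsetP hF e eF; rewrite inE => e2.
  have : (0 < #|e|)%N by rewrite (eqP e2).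
  case/card_gt0P => x _; apply: contraTneq (mem_enum W x) => s0.
  by rewrite -(perm_mem sW) s0.
pose c0 : 'I_r := Ordinal r0.
pose p0 := @power_threshold R th.
have p0_gt0 n : 0 < p0 n by exact: power_threshold_gt0.
have ramsey_p0 : ramsey_threshold F r p0.
  split=> // p p01 pp0; first exact: (ramsey_wins_below hF r0 th0 hm).
  move=> st; apply/cvg_to1P => [N|eps eps0]; first exact: gnp_prob_le1.
  have := achlioptas_loses_above hF r0 th0 sW sn0 hs p01 pp0 (fun N => select_color c0 (st N)).
  move=> /cvg_to1P h.
  have [|n0 {}h] := h _ eps eps0; first by move=> N; exact: gnp_prob_le1.
  exists n0 => N /h /le_trans; apply; apply: gnp_prob_mono => // G _.
  by apply: contra; exact: select_color_wins.
have achl_p0 : achlioptas_threshold F r p0.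
  split=> // p p01 pp0; last exact: (achlioptas_loses_above hF r0 th0 sW sn0 hs p01 pp0).
  have [st hst] := ramsey_wins_below hF r0 th0 hm p01 pp0.
  exists (fun N => select_color c0 (st N)).
  apply/cvg_to1P => [N|eps eps0]; first exact: gnp_prob_le1.
  move: hst => /cvg_to1P h.
  have [|n0 {}h] := h _ eps eps0; first by move=> N; exact: gnp_prob_le1.
  exists n0 => N /h /le_trans; apply; apply: gnp_prob_mono => // G _.
  exact: select_color_wins.
have p0_to0 := power_threshold_to0 r0 th0.
split; first by exists p0.
(* As [p0] tends to 0, [q] is at most a constant times [p0]; hence [q] tends to 0 too, which permits
   the reverse comparison. *)
have same D (wins : forall N, strategy D N r -> graph N r -> bool) q :
    is_threshold wins q -> is_threshold wins p0 -> same_order r q p0.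
  move=> hq hp0; have [C C0 [n0 hC]] := threshold_le r0 hq hp0 p0_to0.
  have [q_gt0 _ _] := hq.
  apply: same_orderP => //; first by exists C => //; exists n0.
  apply: (threshold_le r0 hp0 hq) => eps eps0.
  have [n1 h1] := p0_to0 (eps / C) (divr_gt0 eps0 C0).
  exists (maxn n0 n1) => N; rewrite geq_max => /andP[/hC le /h1].
  by rewrite ler_pdivlMr // mulrC; exact: le_trans.
move=> p1 p2 h1 h2; apply: (eqTheta_trans (same _ _ _ h1 ramsey_p0)).
by rewrite Theta_sym; exact: same h2 achl_p0.
Qed.
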